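(* Let $M$ be an orientable 3-dimensional manifold with volume form $\Omega$, let $B$ be a nowhere-zero $C^1$ vector field on $M$ preserving $\Omega$ (a magnetic field), with flow $\phi_t$, let $\xi$ be a $C^1$ vector field on $M$ (the direction field), and let $\eta$ be a vector field on $M$ (the horizontal field) such that $\Omega(\eta,\xi,B)>0$ everywhere. Let $x_0\in M$ and $\tau>0$ be such that the fieldline $x(t)=\phi_t(x_0)$ is defined for all $t\in[-\tau,\tau]$. For $t\in[-\tau,\tau]$, let $\alpha_t\in T^*_{x_0}M$ be the pullback to $x_0$ along the fieldline flow of the covector $\alpha_0=i_Bi_\xi\Omega$ evaluated at $x(t)$, i.e. $$\alpha_t(w)=\Omega_{x(t)}\big(\xi_{x(t)},\,B_{x(t)},\,D\phi_t(x_0)\,w\big)\qquad\text{for } w\in T_{x_0}M,$$ and, whenever $\alpha_t(\xi_{x_0})\neq 0$, let $$\sigma_t=\frac{\alpha_t(\eta_{x_0})}{\alpha_t(\xi_{x_0})}$$ be its slope. If there are times $t_+,t_-\in[-\tau,\tau]$ such that $\alpha_{t_+}(\xi_{x_0})>0$, $\alpha_{t_-}(\xi_{x_0})<0$ and $\sigma_{t_+}\le\sigma_{t_-}$, then there is no invariant torus for $B$ through $x_0$ transverse to $\xi$.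
   Context: A torus in $M$ means a diffeomorphic image in $M$ of the standard 2-torus $\mathbb{T}^2$, where $\mathbb{T}=\mathbb{R}/\mathbb{Z}$ (an embedded differentiable 2-torus). It is invariant for $B$ if it is invariant under the flow of $B$ (in particular $B$ is tangent to it at each of its points). It is transverse to $\xi$ if $\xi$ is nowhere tangent to it. The flow $\phi_t$ of $B$ is defined by: $\phi_t(x_0)$ is the solution at time $t$ of $\dot x=B(x)$ with $x(0)=x_0$. $D\phi_t(x_0)$ denotes the derivative at $x_0$ of the flow map $\phi_t$. $i_v$ denotes contraction of a differential form with the vector field $v$ in its first slot, so $(i_Bi_\xi\Omega)(w)=\Omega(\xi,B,w)$. *)

(* Defs.v *)
From HB Require Import structures.
From mathcomp Require Import all_boot all_order all_algebra.
From mathcomp Require Import all_classical all_reals all_analysis.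

Set Implicit Arguments.
Unset Strict Implicit.
Unset Printing Implicit Defensive.

Import Order.TTheory GRing.Theory Num.Theory.
Import numFieldNormedType.Exports.

Local Open Scope classical_set_scope.
Local Open Scope ring_scope.

(* Only meant for open U: then the values of f outside U are irrelevant. *)
Fixpoint Ck_on (R : realType) (V W : normedModType R) (k : nat)
    (U : set V) (f : V -> W) : Prop :=
  match k with
  | 0 => forall x, U x -> {for x, continuous f}
  | k'.+1 => (forall x, U x -> differentiable f x) /\
             (forall v, Ck_on k' U (fun x => 'd f x v))
  end.

Definition smooth_on (R : realType) (V W : normedModType R)
    (U : set V) (f : V -> W) : Prop := forall k, Ck_on k U f.

(* A chart is a homeomorphism between the open sets chart_dom and
   chart_fun @` chart_dom; chart_fun and chart_inv are total functions whose
   values outside these sets are irrelevant. *)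
Record chart (R : realType) (n : nat) (X : topologicalType) := Chart {
  chart_dom : set X;
  chart_fun : X -> 'rV[R]_n;
  chart_inv : 'rV[R]_n -> X;
  open_chart_dom : open chart_dom;
  open_chart_cod : open (chart_fun @` chart_dom);
  chart_funK : forall x, chart_dom x -> chart_inv (chart_fun x) = x;
  chart_fun_continuous : forall x, chart_dom x -> {for x, continuous chart_fun};
  chart_inv_continuous : forall p, (chart_fun @` chart_dom) p ->
    {for p, continuous chart_inv}
}.

Definition chart_cod (R : realType) n (X : topologicalType) (c : chart R n X) :=
  chart_fun c @` chart_dom c.

Definition transition (R : realType) n (X : topologicalType)
    (c d : chart R n X) : 'rV[R]_n -> 'rV[R]_n := chart_fun d \o chart_inv c.

Definition transition_dom (R : realType) n (X : topologicalType)
    (c d : chart R n X) : set 'rV[R]_n :=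
  chart_fun c @` (chart_dom c `&` chart_dom d).

Definition smooth_compatible (R : realType) n (X : topologicalType)
    (c d : chart R n X) : Prop :=
  smooth_on (transition_dom c d) (transition c d) /\
  smooth_on (transition_dom d c) (transition d c).

Record manifold (R : realType) (n : nat) := Manifold {
  points :> topologicalType;
  atlas : set (chart R n points);
  chart_at : points -> chart R n points;
  manifold_hausdorff : hausdorff_space points;
  manifold_second_countable : @second_countable points;
  atlas_chart_at : forall x, atlas (chart_at x);
  mem_chart_at : forall x, chart_dom (chart_at x) x;
  atlas_compatible : forall c d, atlas c -> atlas d -> smooth_compatible c d
}.

Definition orientable (R : realType) n (M : manifold R n) : Prop :=
  exists O : set (chart R n M),
    [/\ forall c d, O c -> atlas d -> smooth_compatible c d,
        forall x, exists2 c, O c & chart_dom c x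
      & forall c d p, O c -> O d -> transition_dom c d p ->
          0 < \det ('J (transition c d) p)].

(* The tangent space at x is identified with R^n by the preferred chart
   chart_at x: a tangent vector at x is given by its components in that chart.
   Vector fields, forms and tangent maps below all use these components, and
   their regularity is always tested in every chart of the atlas. *)
Definition tangent (R : realType) n (M : manifold R n) (x : M) := 'rV[R]_n.

Definition vector_field (R : realType) n (M : manifold R n) :=
  forall x : M, tangent x.

Definition to_chart (R : realType) n (M : manifold R n) (c : chart R n M)
    (x : M) (v : tangent x) : 'rV[R]_n :=
  'd (transition (chart_at x) c) (chart_fun (chart_at x) x) v.

Definition of_chart (R : realType) n (M : manifold R n) (c : chart R n M)
    (p v : 'rV[R]_n) : tangent (chart_inv c p) :=
  'd (transition c (chart_at (chart_inv c p))) p v.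

Definition C1_field (R : realType) n (M : manifold R n)
    (X : vector_field M) : Prop :=
  forall c, atlas c ->
    Ck_on 1 (chart_cod c)
      (fun p => to_chart c (X (chart_inv c p))).

Definition tangent_map (R : realType) n (M N : manifold R n) (f : M -> N)
    (x : M) (v : tangent x) : tangent (f x) :=
  'd (chart_fun (chart_at (f x)) \o f \o chart_inv (chart_at x))
     (chart_fun (chart_at x) x) v.

Definition field3 (R : realType) n (M : manifold R n) :=
  forall x : M, tangent x -> tangent x -> tangent x -> R.

Definition differential_3form (R : realType) n (M : manifold R n)
    (Omega : field3 M) : Prop :=
  [/\ forall (x : M) u v,
        [/\ scalar (fun w : 'rV[R]_n => Omega x w u v),
            scalar (fun w : 'rV[R]_n => Omega x u w v)
          & scalar (fun w : 'rV[R]_n => Omega x u v w)],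
      forall (x : M) u v,
        [/\ Omega x u u v = 0, Omega x u v u = 0 & Omega x v u u = 0]
    & forall c, atlas c -> forall u v w : 'rV[R]_n,
        smooth_on (chart_cod c)
          (fun p => Omega (chart_inv c p)
             (of_chart c p u) (of_chart c p v) (of_chart c p w) : R^o)].

Definition volume_form (R : realType) (M : manifold R 3)
    (Omega : field3 M) : Prop :=
  differential_3form Omega /\
  forall x : M, exists u v w : tangent x, Omega x u v w != 0.

Definition integral_curve (R : realType) n (M : manifold R n)
    (X : vector_field M) (J : set R) (g : R -> M) : Prop :=
  forall t, J t ->
    {for t, continuous g} /\
    is_derive t 1 (chart_fun (chart_at (g t)) \o g) (X (g t)).

Definition flow_rel (R : realType) n (M : manifold R n) (X : vector_field M)
    (t : R) (x y : M) : Prop :=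
  exists (a b : R) (g : R -> M),
    [/\ a < 0 < b, a < t < b, integral_curve X `]a, b[ g, g 0 = x & g t = y].

Definition flow_defined (R : realType) n (M : manifold R n)
    (X : vector_field M) (t : R) (x : M) : Prop :=
  exists y, flow_rel X t x y.

(* Equal to x by convention when the solution does not exist up to time t. *)
Definition flow (R : realType) n (M : manifold R n) (X : vector_field M)
    (t : R) (x : M) : M :=
  xget x [set y | flow_rel X t x y].

Definition preserves (R : realType) n (M : manifold R n)
    (X : vector_field M) (Omega : field3 M) : Prop :=
  forall t (x : M), flow_defined X t x -> forall u v w : tangent x,
    Omega (flow X t x) (tangent_map (flow X t) u) (tangent_map (flow X t) v)
      (tangent_map (flow X t) w) = Omega x u v w.

(* A C^1 embedding of T^2 = (R/Z)^2, given by its Z^2-periodic lift to R^2.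
   As T^2 is compact and the manifold is Hausdorff, an injective immersion of
   T^2 is a diffeomorphism onto its image. *)
Record torus (R : realType) n (M : manifold R n) := Torus {
  torus_map : 'rV[R]_2 -> M;
  torus_map_continuous : continuous torus_map;
  torus_map_C1 : forall c : chart R n M, atlas c ->
    Ck_on 1 (torus_map @^-1` chart_dom c) (chart_fun c \o torus_map);
  torus_map_immersion : forall p v : 'rV[R]_2,
    'd (chart_fun (chart_at (torus_map p)) \o torus_map) p v = 0 -> v = 0;
  torus_map_eq : forall p q : 'rV[R]_2,
    torus_map p = torus_map q <->
    exists k : 'rV[int]_2, q = p + map_mx intr k
}.

Definition torus_set (R : realType) n (M : manifold R n) (T : torus M) : set M :=
  range (torus_map T).

Definition tangent_to_torus (R : realType) n (M : manifold R n) (T : torus M)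
    (x : M) (v : tangent x) : Prop :=
  exists p w : 'rV[R]_2, torus_map T p = x /\
    'd (chart_fun (chart_at x) \o torus_map T) p w = v.

Definition torus_transverse (R : realType) n (M : manifold R n)
    (T : torus M) (X : vector_field M) : Prop :=
  forall x : M, torus_set T x -> ~ tangent_to_torus T (X x).

Definition flow_invariant (R : realType) n (M : manifold R n)
    (X : vector_field M) (S : set M) : Prop :=
  forall t x, S x -> flow_defined X t x -> S (flow X t x).

Definition fieldline_covector (R : realType) (M : manifold R 3)
    (Omega : field3 M) (xi B : vector_field M) (x0 : M) (t : R)
    (w : tangent x0) : R :=
  Omega (flow B t x0) (xi (flow B t x0)) (B (flow B t x0))
    (tangent_map (flow B t) w).

Definition fieldline_slope (R : realType) (M : manifold R 3)
    (Omega : field3 M) (xi eta B : vector_field M) (x0 : M) (t : R) : R :=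
  fieldline_covector Omega xi B t (eta x0) /
  fieldline_covector Omega xi B t (xi x0).

(* Main.v *)
Require Import Defs.
From mathcomp Require Import all_boot all_order all_algebra.
From mathcomp Require Import all_classical all_reals all_analysis.
From mathcomp Require Import ring lra.

Set Implicit Arguments.
Unset Strict Implicit.
Unset Printing Implicit Defensive.

Import Order.TTheory GRing.Theory Num.Theory.
Import numFieldNormedType.Exports.

Local Open Scope classical_set_scope.
Local Open Scope ring_scope.

(** Let [T] be an invariant torus through [x0] transverse to [xi].  Its tangent
    plane at [x0] contains [B] and a vector [v] with
    [N := Omega (xi, B, v) <> 0].  The flow maps the tangent plane of [T] at
    [x0] to that at [x(t)], so transversality gives [alpha_t v <> 0] for all
    [t]; by continuity in [t] the sign of [alpha_t v] is that of
    [alpha_0 v = N].  As [alpha_t B = 0], expanding [v] in the basis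
    [(eta, xi, B)] turns [N * alpha_t v > 0] into
    [N^2 alpha_t eta + c alpha_t xi > 0] with [c] independent of [t].
    Dividing by [alpha_t xi] at [t_+] and at [t_-] gives
    [sigma_{t_-} < - c / N^2 < sigma_{t_+}].

    Differentiability of [phi_t] is read off the preservation of [Omega], since
    the differential of a non-differentiable map is [0] by convention.  What
    remains of the theory of ordinary differential equations is that
    [phi_t (y)] exists and is continuous in [y] near [x0] (Picard), and that
    [D phi_t (x0)] is continuous in [t]: for [y] near [x0] and [t] near [t1],
    [phi_t (y) - phi_t (x0)] differs from [phi_t1 (y) - phi_t1 (x0)] by at most
    [C |t - t1| |phi_t1 (y) - phi_t1 (x0)|] in a chart, an estimate which passes
    to the derivatives. *)

(** * Mean value and Gronwall estimates *)
Section Euclid.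
Variable R : realType.

Lemma norm_entry n (v : 'rV[R]_n) i : `|v 0 i| <= `|v|.
Proof.
rewrite [leRHS]/Num.Def.normr/= mx_normrE.
by apply/bigmax_geP; right; exists (0, i).
Qed.

Lemma norm_row_le n (v : 'rV[R]_n) K :
  0 <= K -> (forall i, `|v 0 i| <= K) -> `|v| <= K.
Proof.
move=> K0 vK; rewrite [leLHS]/Num.Def.normr/= mx_normrE.
by rewrite (bigmax_le _ K0)//= => -[i j] _; rewrite ord1.
Qed.

Lemma is_derive_entry n (u : R -> 'rV[R]_n) (t : R) (w : 'rV[R]_n) i :
  is_derive t 1 u w -> is_derive t 1 (fun s => u s 0 i) (w 0 i).
Proof.
move=> ud; have du : derivable u t 1 by exact: ex_derive.
have /derivable_mxP dd := du.
apply: DeriveDef; first exact: dd.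
by rewrite -(@derive_val _ _ _ _ _ _ _ ud) derive_mx// mxE.
Qed.

Lemma is_derive_row n (u : 'I_n -> R -> R) (t : R) (w : 'rV[R]_n) :
  (forall i, is_derive t 1 (u i) (w 0 i)) ->
  is_derive t 1 (fun s => \row_i u i s) w.
Proof.
move=> ud.
have E i j : (fun s : R => (\row_k u k s : 'rV[R]_n) i j) = u j.
  by apply/funext => s; rewrite mxE.
have dd : derivable (fun s => \row_i u i s) t 1.
  by apply/derivable_mxP => i j; rewrite E; exact: ex_derive.
apply: DeriveDef => //; rewrite derive_mx//; apply/rowP => i; rewrite mxE.
by rewrite E; exact: derive_val.
Qed.

Lemma is_derive_continuous (V : normedModType R) (u : R -> V) (t : R) (w : V) :
  is_derive t 1 u w -> {for t, continuous u}.
Proof.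
move=> ud; apply: differentiable_continuous; apply/derivable1_diffP.
exact: ex_derive.
Qed.

(** The mean value theorem fails for vector-valued maps, but the norm on rows is the maximum of the
    entries, so the scalar theorem is applied to each coordinate with its own intermediate point. *)
Lemma norm_sub_le_derive n (u du : R -> 'rV[R]_n) (a b K : R) : a <= b ->
  (forall s, a <= s <= b -> is_derive s 1 u (du s)) ->
  (forall s, a <= s <= b -> `|du s| <= K) -> `|u b - u a| <= K * (b - a).
Proof.
move=> ab ud duK.
have K0 : 0 <= K by apply: le_trans (duK a _); rewrite ?lexx.
apply: norm_row_le => [|i]; first by rewrite mulr_ge0// subr_ge0.
rewrite !mxE.
have [||c /[!in_itv]/= cab ->] :=
  @MVT_segment R (fun s => u s 0 i) (fun s => du s 0 i) a b ab.
- move=> s; rewrite in_itv/= => /andP[as_ sb].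
  by apply: is_derive_entry; apply: ud; rewrite !ltW.
- apply: continuous_in_subspaceT => s /[!inE]; rewrite /= in_itv/= => sab.
  by apply: is_derive_continuous; apply: is_derive_entry; exact: ud.
rewrite normrM (ger0_norm (_ : 0 <= b - a)) ?subr_ge0//.
by rewrite ler_wpM2r ?subr_ge0//; apply: le_trans (norm_entry _ _) (duK _ cab).
Qed.

Lemma mean_value_ball n (u du : R -> 'rV[R]_n) (t0 r K t : R) :
  (forall s, `|s - t0| <= r -> is_derive s 1 u (du s)) ->
  (forall s, `|s - t0| <= r -> `|du s| <= K) ->
  `|t - t0| <= r -> `|u t - u t0| <= K * `|t - t0|.
Proof.
move=> ud duK tr; have [tt0|/ltW tt0] := leP t0 t.
  rewrite (ger0_norm (_ : 0 <= t - t0)) ?subr_ge0//.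
  have tr' : t - t0 <= r by rewrite -[leLHS]ger0_norm ?subr_ge0.
  apply: norm_sub_le_derive => // s /andP[s1 s2]; [apply: ud|apply: duK];
    by rewrite ler_norml; apply/andP; split; lra.
rewrite distrC (distrC t) (ger0_norm (_ : 0 <= t0 - t)) ?subr_ge0//.
have tr' : t0 - t <= r by rewrite -[leLHS]ger0_norm ?subr_ge0// distrC.
apply: norm_sub_le_derive => // s /andP[s1 s2]; [apply: ud|apply: duK];
    by rewrite ler_norml; apply/andP; split; lra.
Qed.

Lemma short_time_gronwall n (d dd : R -> 'rV[R]_n) (t0 r L t : R) : 0 <= L ->
  r * L <= 2^-1 ->
  (forall s, `|s - t0| <= r -> is_derive s 1 d (dd s)) ->
  (forall s, `|s - t0| <= r -> `|dd s| <= L * `|d s|) ->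
  `|t - t0| <= r -> `|d t - d t0| <= 2 * L * `|t - t0| * `|d t0|.
Proof.
move=> L0 rL ddE ddL tr.
have r0 : 0 <= r by exact: le_trans tr.
have ball s : (s \in `[t0 - r, t0 + r]) = (`|s - t0| <= r).
  by rewrite in_itv/= ler_distl.
have [c /[!ball] cr cM] : exists2 c, c \in `[t0 - r, t0 + r] &
    forall s, s \in `[t0 - r, t0 + r] -> `|d s| <= `|d c|.
  apply: (@EVT_max R (fun s => `|d s|)); first lra.
  apply: continuous_in_subspaceT => s /[!inE]; rewrite /= ball => sr.
  apply: (@continuous_comp _ _ _ d Num.norm); last exact: norm_continuous.
  exact: is_derive_continuous (ddE _ sr).
have H s : `|s - t0| <= r -> `|d s - d t0| <= L * `|d c| * `|s - t0|.
  apply: mean_value_ball ddE _ => s' s'r.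
  by rewrite (le_trans (ddL _ s'r))// ler_wpM2l// cM// ball.
have dc : `|d c| <= 2 * `|d t0|.
  have := H c cr; have := lerB_dist (d c) (d t0).
  have : L * `|d c| * `|c - t0| <= 2^-1 * `|d c|.
    rewrite mulrAC ler_wpM2r//; apply: le_trans rL.
    by rewrite mulrC ler_wpM2r.
  by move=> ? ? ?; lra.
apply: le_trans (H t tr) _.
rewrite -!mulrA [leRHS]mulrC -!mulrA; rewrite ler_wpM2l// mulrA.
rewrite [leRHS](_ : _ = (2 * `|d t0|) * `|t - t0|); last by ring.
by rewrite ler_wpM2r.
Qed.

(** The 1-Lipschitz retraction of the line onto a segment, used to extend maps given on a segment or
    a cube to the whole space. *)
Definition clamp (a b x : R) := Num.max a (Num.min b x).

Lemma clamp_id a b x : a <= x <= b -> clamp a b x = x.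
Proof. by move=> /andP[ax xb]; rewrite /clamp (min_r xb) (max_r ax). Qed.

Lemma clamp_itv a b x : a <= b -> a <= clamp a b x <= b.
Proof. by move=> ab; rewrite /clamp le_max lexx/= ge_max ab ge_min lexx. Qed.

Lemma clamp_lipschitz a b x y : a <= b ->
  `|clamp a b x - clamp a b y| <= `|x - y|.
Proof.
move=> ab; rewrite /clamp.
case: (leP b x) => h1; case: (leP b y) => h2; rewrite ?(max_r ab);
  case: (leP a x) => h3; case: (leP a y) => h4; rewrite ?subrr ?normr0//;
  rewrite ler_norml; have := ler_norm (x - y);
  have := ler_norm (y - x); rewrite (distrC y); lra.
Qed.

Lemma lipschitz_continuous (V W : normedModType R) (f : V -> W) K :
  (forall x y, `|f x - f y| <= K * `|x - y|) -> continuous f.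
Proof.
move=> fK x; apply/cvgrPdist_le => e e0.
have K1 : 0 < `|K| + 1 by rewrite ltr_pwDr.
near=> y; apply: le_trans (fK _ _) _.
apply: le_trans (_ : (`|K| + 1) * `|x - y| <= _).
  by rewrite ler_wpM2r// (le_trans (ler_norm _))// lerDl.
rewrite mulrC -ler_pdivlMr//; near: y.
by apply: cvgr_dist_le; [exact: cvg_id|rewrite divr_gt0].
Unshelve. all: by end_near. Qed.

Lemma half_expr_lt (e : R) : 0 < e -> exists n, 2^-1 ^+ n < e.
Proof.
move=> e0; have /cvgrPdist_lt/(_ e e0) : (GRing.exp (2^-1 : R)) @ \oo --> 0.
  by apply: cvg_expr; rewrite ger0_norm ?invr_ge0 //; lra.
case=> N _ /(_ N (leqnn N)); rewrite sub0r normrN ger0_norm ?exprn_ge0 ?invr_ge0//.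
by exists N.
Qed.

Lemma le_of_half_expr (a b C : R) :
  (forall n, a <= b + C * 2^-1 ^+ n) -> a <= b.
Proof.
move=> h; apply/ler_addgt0Pr => e e0.
have C1 : 0 < `|C| + 1 by rewrite ltr_pwDr.
have [n ne] := half_expr_lt (divr_gt0 e0 C1).
apply: le_trans (h n) _; rewrite lerD2l.
have h0 : 0 <= (2^-1 : R) ^+ n by rewrite exprn_ge0// invr_ge0.
apply: le_trans (_ : (`|C| + 1) * 2^-1 ^+ n <= _).
  by rewrite ler_wpM2r// (le_trans (ler_norm _))// lerDl.
by rewrite mulrC -ler_pdivlMr// ltW.
Qed.

(** Nested intervals: with radius [h n] equal to twice the step bound, [x n - h n] increases and
    [x n + h n] decreases, and the supremum of the left ends lies in every interval. This gives the
    limit together with its rate. *)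
Lemma half_cauchy (x : nat -> R) C :
  (forall n, `|x n.+1 - x n| <= C * 2^-1 ^+ n) ->
  exists l, forall n, `|x n - l| <= 2 * C * 2^-1 ^+ n.
Proof.
move=> xC; have C0 : 0 <= C by have := xC 0; rewrite expr0 mulr1; exact: le_trans.
pose h n : R := 2 * C * 2^-1 ^+ n.
have hS n : h n.+1 = h n / 2 by rewrite /h exprS; lra.
have h0 n : 0 <= h n by rewrite /h mulr_ge0 ?exprn_ge0 ?invr_ge0// mulr_ge0.
have xh n : `|x n.+1 - x n| <= h n / 2.
  by apply: le_trans (xC n) _; rewrite /h; lra.
have st m k : x m - h m <= x (m + k)%N - h (m + k)%N /\
              x (m + k)%N + h (m + k)%N <= x m + h m.
  elim: k => [|k [IH1 IH2]]; first by rewrite addn0.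
  have := xh (m + k)%N; rewrite addnS hS ler_norml => /andP[a1 a2].
  by split; lra.
have yz m n : x m - h m <= x n + h n.
  have [mn|/ltnW nm] := leqP m n.
    by have [] := st m (n - m)%N; rewrite subnKC// => ? ?; have := h0 n; lra.
  by have [] := st n (m - n)%N; rewrite subnKC// => ? ?; have := h0 m; lra.
exists (sup (range (fun n => x n - h n))) => n.
rewrite ler_distlC; apply/andP; split.
  apply: ub_le_sup; last by exists n.
  by exists (x 0%N + h 0%N) => _ [m _ <-].
by apply: sup_le_ub; [exists (x 0%N - h 0%N); exists 0%N|move=> _ [m _ <-]].
Qed.

Lemma half_cauchy_row n (x : nat -> 'rV[R]_n) C :
  (forall k, `|x k.+1 - x k| <= C * 2^-1 ^+ k) ->
  exists l, forall k, `|x k - l| <= 2 * C * 2^-1 ^+ k.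
Proof.
move=> xC.
have /choice[l lP] : forall i, exists l, forall k,
    `|x k 0 i - l| <= 2 * C * 2^-1 ^+ k.
  move=> i; apply: half_cauchy => k; apply: le_trans (xC k).
  by have := norm_entry (x k.+1 - x k) i; rewrite !mxE.
have C0 : 0 <= C by have := xC 0; rewrite expr0 mulr1; exact: le_trans.
exists (\row_i l i) => k; apply: norm_row_le => [|i].
  by rewrite !mulr_ge0 ?exprn_ge0 ?invr_ge0.
by rewrite !mxE.
Qed.

End Euclid.

(** * Local solutions of ordinary differential equations *)
Section Ode.
Variable R : realType.

Lemma is_derive_comp (V W : normedModType R) (f : V -> W) (g : R -> V) (t : R)
    (w : V) : differentiable f (g t) -> is_derive t 1 g w ->
  is_derive t 1 (f \o g) ('d f (g t) w).
Proof.
move=> df dg.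
have dg' : differentiable g t by apply/derivable1_diffP; exact: ex_derive.
have dfg := differentiable_comp dg' df.
apply: DeriveDef; first exact: diff_derivable.
have dgw : 'd g t 1 = w by rewrite -deriveE//; exact: derive_val.
by rewrite deriveE// diff_comp//= dgw.
Qed.

Lemma eq_of_derive0 (f : R -> R) (a b : R) :
  (forall s, Num.min a b <= s <= Num.max a b -> is_derive s 1 f 0) -> f a = f b.
Proof.
wlog ab : a b / a <= b.
  move=> H fd; have [ab|/ltW ba] := leP a b; first exact: H.
  by apply/esym/H => // s; rewrite minC maxC; exact: fd.
rewrite min_l// max_r// => fd; apply/esym/eqP; rewrite -subr_eq0; apply/eqP.
have [||c _ ->] := @MVT_segment R f (fun=> 0) a b ab; last by rewrite mul0r.
- by move=> s; rewrite in_itv/= => /andP[as_ sb]; apply: fd; rewrite !ltW.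
- apply: continuous_in_subspaceT => s /[!inE]; rewrite /= in_itv/= => sab.
  exact: is_derive_continuous (fd _ sab).
Qed.

(** Connectedness of the interval: the indicator of [P] is locally constant, so its derivative is
    zero and it is constant. This continuation principle carries uniqueness of solutions, the
    openness of the flow domain and the sign of the covector along the fieldline. *)
Lemma interval_locally_constant (P : R -> Prop) (a b t0 : R) :
  (forall t, a < t < b -> \forall s \near t, P s <-> P t) ->
  a < t0 < b -> P t0 -> forall t, a < t < b -> P t.
Proof.
move=> Ploc t0ab Pt0 t tab; pose f s : R := if `[< P s >] then 1 else 0.
suff : f t0 = f t by rewrite /f (asboolT Pt0); case: asboolP => // _ /eqP; rewrite oner_eq0.
apply: eq_of_derive0 => s sm.
have sab : a < s < b.
  move: sm; rewrite ge_min le_max.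
  by move: t0ab tab => /andP[? ?] /andP[? ?] /andP[/orP[]? /orP[]?]; apply/andP; split; lra.
have := is_derive_cst (f s) s (1 : R); apply: near_eq_is_derive.
have := Ploc s sab; apply: filterS => r rs /=.
by rewrite /f; congr (if _ then _ else _); apply: asbool_equiv_eq; split => /rs.
Qed.

Lemma primitive_exists (f : R -> R) : continuous f ->
  exists2 G : R -> R, G 0 = 0 & forall t : R, is_derive t 1 G (f t).
Proof.
move=> cf; pose mu := @lebesgue_measure R.
(* [G N] is a primitive on []-N, N[] only. Any two of these agree where both are valid, because both
   vanish at [0], so they glue to a primitive on the line. *)
pose G N x : R := (\int[mu]_(s in `[- N, x]) f s)%R - (\int[mu]_(s in `[- N, 0%R]) f s)%R.
have GN0 N : G N 0 = 0 by rewrite /G subrr.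
have GN (N t : R) : `|t| < N -> is_derive t 1 (G N) (f t).
  rewrite ltr_norml => /andP[Nt tN].
  have intf : mu.-integrable `[- N, N] (EFin \o f).
    apply: continuous_compact_integrable; first exact: segment_compact.
    exact: continuous_subspaceT.
  have [|d1 d2] := @continuous_FTC1 R f (BLeft (- N)) t N tN intf _ (cf t).
    by rewrite /Order.lt.
  have dI : is_derive t 1 (fun x => \int[mu]_(s in `[- N, x]) f s)%R (f t).
    apply: DeriveDef; first exact: d1.
    by rewrite -derive1E; exact: d2.
  by have := is_deriveB dI (is_derive_cst ((\int[mu]_(s in `[- N, 0%R]) f s)%R) t 1); rewrite subr0.
have GNN (N N' t : R) : `|t| < N -> `|t| < N' -> G N t = G N' t.
  move=> tN tN'; apply/eqP; rewrite -subr_eq0; apply/eqP.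
  rewrite -[RHS](_ : G N 0 - G N' 0 = 0); last by rewrite !GN0 subrr.
  apply: (@eq_of_derive0 (fun s => G N s - G N' s)) => s.
  rewrite ge_min le_max => sb.
  have st : `|s| <= `|t|.
    have := ler_norm t; have := ler_norm (- t); rewrite normrN ler_norml.
    by case/andP: sb => /orP[]? /orP[]? ? ?; apply/andP; split; lra.
  have := is_deriveB (GN _ _ (le_lt_trans st tN)) (GN _ _ (le_lt_trans st tN')).
  by rewrite subrr.
exists (fun t => G (`|t| + 1) t) => [|t]; first exact: GN0.
have tt : `|t| < `|t| + 2 by rewrite ltrDl.
apply: near_eq_is_derive (GN _ _ tt).
have : \forall s \near t, `|s| < `|t| + 1.
  have ct : (fun s : R => `|s|) @ t --> `|t| by exact: norm_continuous.
  by apply: (cvgr_lt _ ct); rewrite ltrDl.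
by apply: filterS => s st; apply: GNN; lra.
Qed.

Lemma row_primitive_exists n (f : R -> 'rV[R]_n) : continuous f ->
  exists2 G : R -> 'rV[R]_n, G 0 = 0 & forall t : R, is_derive t 1 G (f t).
Proof.
move=> cf; have /choice[G GP] : forall i, exists G : R -> R,
    G 0 = 0 /\ forall t : R, is_derive t 1 G (f t 0 i).
  move=> i; have [|G G0 dG] := @primitive_exists (fun t => f t 0 i); last by exists G.
  move=> t; apply: (@continuous_comp _ _ _ f (fun v : 'rV[R]_n => v 0 i)).
    exact: cf.
  apply: (@lipschitz_continuous R 'rV[R]_n R (fun v => v 0 i) 1) => x y; rewrite mul1r.
  by have := norm_entry (x - y) i; rewrite !mxE.
exists (fun t => \row_i G i t) => [|t].
  by apply/rowP => i; rewrite !mxE; have [] := GP i.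
by apply: is_derive_row => i; have [_] := GP i.
Qed.

(** Successive approximation: on [[-e, e]] each iteration shrinks the difference of consecutive
    iterates by [e * L <= 1/2]. As [F] is defined, bounded and Lipschitz everywhere, no iterate has
    to be confined to a domain. *)
Lemma picard n (F : 'rV[R]_n -> 'rV[R]_n) (L K e : R) (p : 'rV[R]_n) :
  0 <= e -> 0 <= L -> e * L <= 2^-1 ->
  (forall x y, `|F x - F y| <= L * `|x - y|) -> (forall x, `|F x| <= K) ->
  exists u : R -> 'rV[R]_n, u 0 = p /\
    forall t : R, `|t| <= e -> is_derive t 1 u (F (u t)).
Proof.
move=> e0 L0 eL FL FK.
have K0 : 0 <= K by exact: le_trans (FK 0).
have cF : continuous F by exact: lipschitz_continuous FL.
(* [prim f] is the primitive with value [p] at [0]; for discontinuous [f] an arbitrary value is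
   chosen. *)
have /choice[prim primP] : forall f : R -> 'rV[R]_n, exists G : R -> 'rV[R]_n,
    continuous f -> G 0 = p /\ forall t : R, is_derive t 1 G (f t).
  move=> f; have [cf|ncf] := pselect (continuous f); last by exists f.
  have [G G0 dG] := row_primitive_exists cf.
  exists (fun t => G t + p) => _; rewrite G0 add0r; split=> // t.
  by have := is_deriveD (dG t) (is_derive_cst p t 1); rewrite addr0.
pose u := fix u k := if k is k'.+1 then prim (F \o u k') else cst p.
have cu k : continuous (u k).
  elim: k => [|k IH] t /=; first exact: cst_continuous.
  have cFu : continuous (F \o u k) by move=> s; exact: continuous_comp (IH s) (cF _).
  by have [_ dG] := primP _ cFu; exact: is_derive_continuous (dG t).
have uS k : u k.+1 0 = p /\ forall t : R, is_derive t 1 (u k.+1) (F (u k t)).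
  by apply: primP => t; exact: continuous_comp (cu k t) (cF _).
have u0 k : u k 0 = p by case: k => // k; have [] := uS k.
have uD k (t : R) : `|t| <= e -> `|u k.+1 t - u k t| <= (e * K) * 2^-1 ^+ k.
  elim: k t => [|k IH] t te.
    rewrite expr0 mulr1 mulrC (_ : u 0%N t = p)//.
    have := @mean_value_ball R n (u 1%N) (fun s => F (u 0 s)) 0 e K t.
    rewrite subr0 u0 => H; apply: le_trans (H _ _ te) _.
    - by move=> s _; have [_] := uS 0%N.
    - by move=> s _; exact: FK.
    - by rewrite ler_wpM2l.
  have := @mean_value_ball R n (fun s => u k.+2 s - u k.+1 s)
    (fun s => F (u k.+1 s) - F (u k s)) 0 e (L * ((e * K) * 2^-1 ^+ k)) t.
  rewrite subr0 !u0 subrr subr0 => H; apply: le_trans (H _ _ te) _.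
  - by move=> s _; apply: is_deriveB; [have [_] := uS k.+1|have [_] := uS k].
  - move=> s; rewrite subr0 => se.
    by apply: le_trans (FL _ _) _; rewrite ler_wpM2l// IH.
  - rewrite exprS; set E := 2^-1 ^+ k.
    have E0 : 0 <= E by rewrite exprn_ge0 ?invr_ge0.
    apply: le_trans (_ : L * (e * K * E) * e <= _).
      by rewrite ler_wpM2l// !mulr_ge0.
    rewrite [leLHS](_ : _ = (e * L) * (e * K * E)); last by ring.
    rewrite [leRHS](_ : _ = 2^-1 * (e * K * E)); last by ring.
    by rewrite ler_wpM2r// !mulr_ge0.
have Ne : - e <= e by lra.
have clampe t : `|clamp (- e) e t| <= e by rewrite ler_norml clamp_itv.
(* The iterates converge only on [[-e, e]]. Clamping the time makes the limit [v] a Lipschitz map on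
   the whole line, so that [prim (F \o v)] is a genuine primitive. *)
have /choice[v vP] : forall t : R, exists l, forall k,
    `|u k (clamp (- e) e t) - l| <= 2 * (e * K) * 2^-1 ^+ k.
  by move=> t; apply: half_cauchy_row => k; exact: uD.
have clamp_e t : `|t| <= e -> clamp (- e) e t = t.
  by rewrite ler_norml => te; exact: clamp_id.
have uL k (s t : R) : `|s| <= e -> `|t| <= e -> `|u k s - u k t| <= K * `|s - t|.
  case: k => [|k] se te; first by rewrite subrr normr0 mulr_ge0.
  have [st|/ltW ts] := leP t s.
    rewrite (ger0_norm (_ : 0 <= s - t)) ?subr_ge0//.
    apply: (@norm_sub_le_derive R n (u k.+1) (F \o u k)) => // r _; last exact: FK.
    by have [_] := uS k.
  rewrite distrC (distrC s) (ger0_norm (_ : 0 <= t - s)) ?subr_ge0//.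
  apply: (@norm_sub_le_derive R n (u k.+1) (F \o u k)) => // r _; last exact: FK.
  by have [_] := uS k.
have vL (s t : R) : `|v s - v t| <= K * `|s - t|.
  apply: (@le_of_half_expr R _ _ (2 * (2 * (e * K)))) => k.
  have := uL k _ _ (clampe s) (clampe t).
  have := ler_wpM2l K0 (clamp_lipschitz s t Ne).
  have := vP s k; have := vP t k.
  set cs := clamp _ _ s; set ct := clamp _ _ t => h1 h2 h3 h4.
  have -> : v s - v t = (u k ct - v t) - (u k cs - v s) + (u k cs - u k ct).
    by apply/rowP => i; rewrite !mxE; ring.
  apply: le_trans (ler_normD _ _) _; have := ler_normB (u k ct - v t) (u k cs - v s).
  by move=> ?; lra.
have cv : continuous v by exact: lipschitz_continuous vL.
have [W0 dW] : prim (F \o v) 0 = p /\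
    forall t : R, is_derive t 1 (prim (F \o v)) (F (v t)).
  by apply: primP => t; exact: continuous_comp (cv t) (cF _).
exists (prim (F \o v)); split=> // t te.
(* Both sides are within a multiple of [2^-1 ^+ k] of [u k.+1 t], for every [k]. *)
suff -> : prim (F \o v) t = v t by exact: dW.
apply/eqP; rewrite -subr_eq0 -normr_le0.
apply: (@le_of_half_expr R _ _ ((2^-1 + 1) * (2 * (e * K)))) => k; rewrite add0r.
have uv s : `|s| <= e -> `|u k s - v s| <= 2 * (e * K) * 2^-1 ^+ k.
  by move=> se; have := vP s k; rewrite clamp_e.
set E := 2 * (e * K) * 2^-1 ^+ k in uv *.
have E0 : 0 <= E by rewrite !mulr_ge0 ?exprn_ge0 ?invr_ge0.
have := @mean_value_ball R n (fun s => u k.+1 s - prim (F \o v) s)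
    (fun s => F (u k s) - F (v s)) 0 e (L * E) t.
rewrite subr0 (u0 k.+1) W0 subrr subr0 => H.
have {}H : `|u k.+1 t - prim (F \o v) t| <= L * E * `|t|.
  apply: H te => s; rewrite subr0 => se.
    by apply: is_deriveB; have [] := uS k.
  by apply: le_trans (FL _ _) _; rewrite ler_wpM2l// uv.
have H1 : L * E * `|t| <= 2^-1 * E.
  apply: le_trans (_ : L * E * e <= _); first by rewrite ler_wpM2l// mulr_ge0.
  by rewrite mulrAC ler_wpM2r// mulrC.
have H2 : `|u k.+1 t - v t| <= 2^-1 * E.
  have := vP t k.+1; rewrite clamp_e// exprS /E; lra.
have -> : prim (F \o v) t - v t =
    (u k.+1 t - v t) - (u k.+1 t - prim (F \o v) t).
  by apply/rowP => i; rewrite !mxE; ring.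
apply: le_trans (ler_normB _ _) _; rewrite -mulrA -/E; lra.
Qed.

Lemma small_factor (k A eps : R) : 0 <= k -> 0 <= A -> 0 < eps ->
  exists e, [/\ 0 < e, e * k <= 2^-1 & e * A <= eps].
Proof.
move=> k0 A0 eps0; pose e := Num.min (2 * (k + 1))^-1 (eps / (A + 1)).
have e0 : 0 < e by rewrite lt_min invr_gt0 divr_gt0//; lra.
exists e; split => //.
  apply: le_trans (_ : (2 * (k + 1))^-1 * (k + 1) <= _).
    by apply: ler_pM => //; [exact/ltW|rewrite ge_min lexx|lra].
  by rewrite invfM -mulrA mulVf ?mulr1//; lra.
apply: le_trans (_ : eps / (A + 1) * (A + 1) <= _).
  by apply: ler_pM => //; [exact/ltW|rewrite ge_min lexx orbT|lra].
by rewrite divfK// gt_eqF//; lra.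
Qed.

Lemma linear_row_bound n (W : normedModType R) (f : {linear 'rV[R]_n -> W}) v :
  `|f v| <= (\sum_j `|f (delta_mx 0 j)|) * `|v|.
Proof.
rewrite {1}(row_sum_delta v) linear_sum/=.
apply: le_trans (ler_norm_sum _ _ _) _; rewrite mulr_suml; apply: ler_sum => j _.
by rewrite linearZ normrZ mulrC; apply: ler_pM => //; exact: norm_entry.
Qed.

Lemma linear_row_continuous n (W : normedModType R) (f : {linear 'rV[R]_n -> W}) :
  continuous f.
Proof.
apply: (@lipschitz_continuous R _ _ _ (\sum_j `|f (delta_mx 0 j)|)) => x y.
by rewrite -linearB; exact: linear_row_bound.
Qed.

Lemma is_derive_segment (V : normedModType R) (y v : V) (s : R) :
  is_derive s 1 (fun s => y + s *: v) v.
Proof.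
have dZ : is_diff s ( *:%R^~ v : R -> V) ( *:%R^~ v) := is_diff_scalel s v.
have dl : is_diff s (cst y + ( *:%R^~ v : R -> V)) (0 + ( *:%R^~ v)) .
  by have dc : is_diff s (cst y : R -> V) 0 := is_diff_cst y s; apply: is_diffD.
have dl' : differentiable (fun s : R => y + s *: v) s := @ex_diff _ _ _ _ _ _ _ dl.
apply: DeriveDef; first exact: diff_derivable.
rewrite deriveE// (diff_val : 'd (fun s : R => y + s *: v) s = _ :> (R -> V)) /=.
by rewrite !fctE scale1r add0r.
Qed.

(** The finitely many partial derivatives are continuous, hence bounded near [p], and their bounds
    add up to [L]. Balls are convex, so the mean value inequality applies along the segment from [y]
    to [x]. *)
Lemma C1_locally_lipschitz n (U : set 'rV[R]_n) (X : 'rV[R]_n -> 'rV[R]_n) p :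
  open U -> Ck_on 1 U X -> U p -> exists r L K : R,
    [/\ 0 < r, 0 <= L, 0 <= K,
      forall x, `|x - p| <= r -> U x /\ `|X x| <= K &
      forall x y, `|x - p| <= r -> `|y - p| <= r ->
        `|X x - X y| <= L * `|x - y|].
Proof.
move=> oU [dX cX] Up.
pose M (j : 'I_n) := `|'d X p (delta_mx 0 j : 'rV[R]_n)| + 1.
have XK : \forall x \near p, `|X x| < `|X p| + 1.
  have cXp : {for p, continuous X} by exact/differentiable_continuous/dX.
  have c : (fun x => `|X x|) @ p --> `|X p| by exact: cvg_norm cXp.
  by apply: (cvgr_lt _ c); rewrite ltrDl.
have dXMj (j : 'I_n) : \forall x \near p, `|'d X x (delta_mx 0 j : 'rV[R]_n)| < M j.
  have c : (fun x => `|'d X x (delta_mx 0 j : 'rV[R]_n)|) @ p -->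
      `|'d X p (delta_mx 0 j : 'rV[R]_n)|.
    have cXp : {for p, continuous (fun x => 'd X x (delta_mx 0 j : 'rV[R]_n))}.
      exact: cX.
    exact: cvg_norm cXp.
  by apply: (cvgr_lt _ c); rewrite ltrDl.
have dXM : \forall x \near p, forall j : 'I_n,
    `|'d X x (delta_mx 0 j : 'rV[R]_n)| < M j by exact: filter_forall dXMj.
have Unear : \forall x \near p, U x by exact: open_nbhs_nbhs.
have : \forall x \near p, U x /\ `|X x| < `|X p| + 1 /\
    forall j : 'I_n, `|'d X x (delta_mx 0 j : 'rV[R]_n)| < M j.
  by apply: filterI => //; exact: filterI.
move=> /nbhs_ballP[r /= r0 rP].
have rb x : `|x - p| <= r / 2 -> ball p r x.
  move=> xp; rewrite -ball_normE/= distrC; apply: le_lt_trans xp _; lra.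
have L0 : 0 <= \sum_j M j by apply: sumr_ge0 => j _; rewrite addr_ge0.
exists (r / 2), (\sum_j M j), (`|X p| + 1); split; [by rewrite divr_gt0|by []|by rewrite addr_ge0|..].
  by move=> x /rb/rP[? [/ltW ? _]].
move=> x y xr yr.
have seg s : 0 <= s <= 1 -> `|y + s *: (x - y) - p| <= r / 2.
  move=> /andP[s0 s1].
  have -> : y + s *: (x - y) - p = (1 - s) *: (y - p) + s *: (x - p).
    by apply/rowP => i; rewrite !mxE; ring.
  apply: le_trans (ler_normD _ _) _; rewrite !normrZ (ger0_norm s0) ger0_norm ?subr_ge0//.
  have : (1 - s) * `|y - p| <= (1 - s) * (r / 2) by rewrite ler_wpM2l// subr_ge0.
  have : s * `|x - p| <= s * (r / 2) by rewrite ler_wpM2l.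
  lra.
have := @norm_sub_le_derive R n (X \o (fun s => y + s *: (x - y)))
  (fun s => 'd X (y + s *: (x - y)) (x - y)) 0 1 ((\sum_j M j) * `|x - y|) ler01.
rewrite /= scale1r scale0r addr0 subrKC subr0 mulr1; apply.
  move=> s s01; apply: is_derive_comp; last exact: is_derive_segment.
  by have [/dX] := rP _ (rb _ (seg _ s01)).
move=> s s01; have [_ [_ dM]] := rP _ (rb _ (seg _ s01)).
apply: le_trans (linear_row_bound _ _) _; rewrite ler_wpM2r//.
by apply: ler_sum => j _; exact/ltW.
Qed.

(** Balls of the maximum norm are cubes, so clamping each coordinate retracts the space onto the
    closed ball of radius [r] around [p]. *)
Definition clamp_row n (p : 'rV[R]_n) r (x : 'rV[R]_n) : 'rV[R]_n :=
  \row_i clamp (p 0 i - r) (p 0 i + r) (x 0 i).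

Lemma clamp_row_id n (p : 'rV[R]_n) r x : `|x - p| <= r -> clamp_row p r x = x.
Proof.
move=> xr; apply/rowP => i; rewrite mxE clamp_id// -ler_distl.
by apply: le_trans xr; have := norm_entry (x - p) i; rewrite !mxE.
Qed.

Lemma clamp_row_ball n (p : 'rV[R]_n) r x : 0 <= r -> `|clamp_row p r x - p| <= r.
Proof.
move=> r0; apply: norm_row_le => // i; rewrite !mxE ler_distl clamp_itv//; lra.
Qed.

Lemma clamp_row_lipschitz n (p : 'rV[R]_n) r x y : 0 <= r ->
  `|clamp_row p r x - clamp_row p r y| <= `|x - y|.
Proof.
move=> r0; apply: norm_row_le => // i; rewrite !mxE.
have h : p 0 i - r <= p 0 i + r by lra.
apply: le_trans (clamp_lipschitz _ _ h) _.
by have := norm_entry (x - y) i; rewrite !mxE.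
Qed.

(* Picard's theorem applied to the field precomposed with the retraction onto
   a cube; short-time solutions never leave the cube. *)
Lemma local_ode_solution n (X : 'rV[R]_n -> 'rV[R]_n) p (r L K : R) :
  0 < r -> 0 <= L -> 0 <= K ->
  (forall x, `|x - p| <= r -> `|X x| <= K) ->
  (forall x y, `|x - p| <= r -> `|y - p| <= r -> `|X x - X y| <= L * `|x - y|) ->
  exists e : R, [/\ 0 < e, e * L <= 2^-1 & forall q, `|q - p| <= r / 2 ->
    exists u : R -> 'rV[R]_n, u 0 = q /\
      forall t : R, `|t| <= e -> `|u t - p| <= r /\ is_derive t 1 u (X (u t))].
Proof.
move=> r0 L0 K0 XK XL.
(* The first bound makes the Picard iteration contract; the second limits the displacement to
   [r / 2], so solutions started within [r / 2] of [p] stay within [r]. *)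
pose e := Num.min (2 * (L + 1))^-1 (r / (2 * (K + 1))).
have e0 : 0 < e by rewrite lt_min invr_gt0 divr_gt0//; lra.
have eL : e * L <= 2^-1.
  apply: le_trans (_ : (2 * (L + 1))^-1 * (L + 1) <= _).
    by apply: ler_pM => //; [exact/ltW|rewrite ge_min lexx|lra].
  by rewrite invfM -mulrA mulVf ?mulr1//; lra.
have eK : K * e <= r / 2.
  apply: le_trans (_ : (K + 1) * (r / (2 * (K + 1))) <= _).
    by apply: ler_pM => //; [exact/ltW|lra|rewrite ge_min lexx orbT].
  have K1 : K + 1 != 0 by rewrite gt_eqF//; lra.
  by rewrite le_eqVlt; apply/orP; left; apply/eqP; field.
exists e; split=> // q qp.
have [||u [u0 du]] := @picard n (X \o clamp_row p r) L K e q (ltW e0) L0 eL.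
- move=> x y /=; apply: le_trans (XL _ _ _ _) _; try by apply: clamp_row_ball; exact: ltW.
  by rewrite ler_wpM2l// clamp_row_lipschitz// ltW.
- by move=> x; apply: XK; apply: clamp_row_ball; exact: ltW.
exists u; split=> // t te.
have ur : `|u t - p| <= r.
  have : `|u t - u 0| <= K * `|t - 0|.
    apply: (@mean_value_ball R n u (fun s => X (clamp_row p r (u s))) 0 e) => [s|s _|].
    - by rewrite subr0 => /du.
    - by apply: XK; apply: clamp_row_ball; exact: ltW.
    - by rewrite subr0.
  rewrite u0 subr0 => h1.
  have h2 : K * `|t| <= K * e by rewrite ler_wpM2l.
  have := ler_normD (u t - q) (q - p); rewrite addrA subrK; lra.
by split=> //; have := du t te; rewrite /= clamp_row_id.
Qed.

End Ode.

(** * Charts and flows *)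
Section Calculus.
Variable R : realType.

Lemma diff_near0 (V W : normedModType R) (f : V -> W) x e :
  differentiable f x -> 0 < e ->
  \forall h \near (0 : V), `|f (h + x) - f x - 'd f x h| <= e * `|h|.
Proof.
move=> /diff_locally/eqaddoP H e0; have := H e e0.
by apply: filterS => h /=; rewrite !fctE /= opprD addrA.
Qed.

Lemma near_eq_diff (V W : normedModType R) (f g : V -> W) x :
  {near x, f =1 g} -> differentiable f x ->
  differentiable g x /\ 'd g x = 'd f x :> (V -> W).
Proof.
move=> fg df; have cdf := diff_continuous df.
have H : g \o shift x = cst (g x) + 'd f x +o_0 id.
  apply/eqaddoP => e e0; have := diff_near0 df e0.
  have fg0 : \forall h \near (0 : V), f (h + x) = g (h + x).
    have cs : (fun h : V => h + x) @ (0 : V) --> x.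
      by rewrite -[X in _ --> X]add0r; apply: cvgD; [exact: cvg_id|exact: cvg_cst].
    exact: cs _ fg.
  rewrite -(nbhs_singleton fg).
  move=> H; apply: filterS2 H fg0 => h /= + fgh.
  by rewrite !fctE /= -fgh opprD addrA.
have dgE := diff_unique cdf H.
split; last exact: dgE.
by apply/diff_locallyP; rewrite dgE; split; [exact: cdf|exact: H].
Qed.

Lemma near_closed_ball (t e : R) (P : R -> Prop) : 0 < e ->
  (\forall s \near t, P s) ->
  exists rho, [/\ 0 < rho, rho <= e & forall s, `|s - t| <= rho -> P s].
Proof.
move=> e0 /nbhs_ballP[r /= r0 rP]; exists (Num.min e (r / 2)).
rewrite lt_min e0 divr_gt0// ge_min lexx; split=> // s.
rewrite le_min => /andP[_ sr]; apply: rP.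
by rewrite -ball_normE/= distrC; apply: le_lt_trans sr _; lra.
Qed.

Lemma near_itvoo (a b t : R) : a < t < b -> \forall s \near t, a < s < b.
Proof.
move=> tab; have /near_in_itvoo : t \in `]a, b[%R by rewrite in_itv.
by apply: filterS => s; rewrite in_itv.
Qed.

End Calculus.

(** * Changes of chart and their differentials *)

Section Charts.
Variables (R : realType) (n : nat) (M : manifold R n).
Implicit Types (c d e : chart R n M) (x : M).

Lemma near_chart_dom c x : chart_dom c x -> \forall y \near x, chart_dom c y.
Proof. by move=> cx; apply: open_nbhs_nbhs; split => //; exact: open_chart_dom. Qed.

Lemma mem_chart_cod c x : chart_dom c x -> chart_cod c (chart_fun c x).
Proof. by exists x. Qed.

Lemma chart_inv_dom c p : chart_cod c p -> chart_dom c (chart_inv c p).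
Proof. by move=> [x cx <-]; rewrite chart_funK. Qed.

Lemma chart_invK c p : chart_cod c p -> chart_fun c (chart_inv c p) = p.
Proof. by move=> [x cx <-]; rewrite chart_funK. Qed.

Lemma near_chart_cod c p : chart_cod c p -> \forall q \near p, chart_cod c q.
Proof. by move=> cp; apply: open_nbhs_nbhs; split => //; exact: open_chart_cod. Qed.

Lemma transition_differentiable c d x : atlas c -> atlas d ->
  chart_dom c x -> chart_dom d x ->
  differentiable (transition c d) (chart_fun c x).
Proof.
move=> ac ad cx dx; have [/(_ 1%N)[H _] _] := atlas_compatible ac ad.
by apply: H; exists x.
Qed.

Lemma near_transition (V : topologicalType) (f : V -> M) p c d :
  {for p, continuous f} -> chart_dom c (f p) ->
  {near p, transition c d \o (chart_fun c \o f) =1 chart_fun d \o f}.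
Proof.
move=> cf cfp; have := cf _ (near_chart_dom cfp).
by rewrite /prop_near1 /nbhs/=; apply: filterS => q cq /=; rewrite /transition/= chart_funK.
Qed.

Lemma diff_chart_change (V : normedModType R) (f : V -> M) p c d :
  atlas c -> atlas d -> {for p, continuous f} ->
  chart_dom c (f p) -> chart_dom d (f p) ->
  differentiable (chart_fun c \o f) p ->
  differentiable (chart_fun d \o f) p /\
  forall v, 'd (chart_fun d \o f) p v =
    'd (transition c d) (chart_fun c (f p)) ('d (chart_fun c \o f) p v).
Proof.
move=> ac ad cf cfp dfp df; have dt := transition_differentiable ac ad cfp dfp.
have [dg dgE] := near_eq_diff (near_transition d cf cfp) (differentiable_comp df dt).
split; first exact: dg.
by move=> v; exact: etrans (congr1 (@^~ v) dgE) (congr1 (@^~ v) (diff_comp df dt)).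
Qed.

Lemma is_derive_chart_change (g : R -> M) (t : R) w c d :
  atlas c -> atlas d -> {for t, continuous g} ->
  chart_dom c (g t) -> chart_dom d (g t) ->
  is_derive t 1 (chart_fun c \o g) w ->
  is_derive t 1 (chart_fun d \o g) ('d (transition c d) (chart_fun c (g t)) w).
Proof.
move=> ac ad cg cgt dgt dg; have dt := transition_differentiable ac ad cgt dgt.
exact: near_eq_is_derive (near_transition d cg cgt) (is_derive_comp dt dg).
Qed.

Lemma diff_transition_comp c d e x v : atlas c -> atlas d -> atlas e ->
  chart_dom c x -> chart_dom d x -> chart_dom e x ->
  'd (transition d e) (chart_fun d x) ('d (transition c d) (chart_fun c x) v) =
  'd (transition c e) (chart_fun c x) v.
Proof.
move=> ac ad ae cx dx ex.
have := @diff_chart_change _ (chart_inv c) (chart_fun c x) d e ad ae.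
rewrite (chart_funK cx) => H; have [||_ H2] := H _ dx ex.
- by apply: chart_inv_continuous; exact: mem_chart_cod.
- exact: (transition_differentiable ac ad cx dx).
- exact/esym/H2.
Qed.

Lemma diff_transition_id c x v : chart_dom c x ->
  'd (transition c c) (chart_fun c x) v = v.
Proof.
move=> cx.
have did : differentiable (@id 'rV[R]_n) (chart_fun c x) by exact: ex_diff.
have [|_ ->] := @near_eq_diff _ _ _ id (transition c c) (chart_fun c x) _ did.
  have := near_chart_cod (mem_chart_cod cx).
  by apply: filterS => q cq; rewrite /transition/= chart_invK.
by rewrite diff_val.
Qed.

Lemma diff_transitionK c d x v : atlas c -> atlas d ->
  chart_dom c x -> chart_dom d x ->
  'd (transition d c) (chart_fun d x) ('d (transition c d) (chart_fun c x) v) = v.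
Proof. by move=> *; rewrite diff_transition_comp// diff_transition_id. Qed.

Lemma chart_at_inj c x y : chart_dom c x -> chart_dom c y ->
  chart_fun c x = chart_fun c y -> x = y.
Proof. by move=> cx cy E; rewrite -(chart_funK cx) E chart_funK. Qed.

End Charts.

(** * Integral curves and the flow of a field on a manifold *)

Section Flow.
Variables (R : realType) (n : nat) (M : manifold R n) (B : vector_field M).
Hypothesis B_C1 : C1_field B.
Implicit Types (c d : chart R n M) (x : M) (g : R -> M).

Definition field_in c (p : 'rV[R]_n) : 'rV[R]_n :=
  to_chart c (B (chart_inv c p)).

Lemma field_inE c x : chart_dom c x ->
  field_in c (chart_fun c x) =
  'd (transition (chart_at x) c) (chart_fun (chart_at x) x) (B x).
Proof. by move=> cx; rewrite /field_in chart_funK. Qed.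

Definition integral_at g (t : R) := {for t, continuous g} /\
  is_derive t 1 (chart_fun (chart_at (g t)) \o g) (B (g t)).

Lemma integral_at_near g h (t : R) :
  (\forall s \near t, g s = h s) -> integral_at g t -> integral_at h t.
Proof.
move=> gh [cg dg]; have E := nbhs_singleton gh; split.
  suff : h @ t --> h t by [].
  by rewrite -E; apply: cvg_trans cg; exact: near_eq_cvg.
rewrite -E; apply: near_eq_is_derive dg.
by apply: filterS gh => s /= ->.
Qed.

Lemma integral_at_shift g (t k : R) :
  integral_at g (t - k) -> integral_at (fun s => g (s - k)) t.
Proof.
move=> [cg dg]; split.
  apply: (@continuous_comp _ _ _ (fun s => s - k) g) => //.
  by apply: cvgB; [exact: cvg_id|exact: cvg_cst].
have ds : is_derive t 1 (fun s : R => s - k) (1 : R).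
  by have := is_derive_shift t (1 : R) (- k).
have /derivable1_diffP df : derivable (chart_fun (chart_at (g (t - k))) \o g) (t - k) 1.
  exact: ex_derive.
have := @is_derive_comp R R _ _ (fun s => s - k) t 1 df ds.
by rewrite -deriveE// derive_val.
Qed.

Lemma integral_at_chart g (t : R) c : atlas c -> chart_dom c (g t) ->
  integral_at g t -> is_derive t 1 (chart_fun c \o g) (field_in c (chart_fun c (g t))).
Proof.
move=> ac cgt [cg dg]; rewrite field_inE//.
by apply: is_derive_chart_change dg => //; [exact: atlas_chart_at|exact: mem_chart_at].
Qed.

Lemma integral_at_of_chart c (u : R -> 'rV[R]_n) (t : R) : atlas c ->
  chart_cod c (u t) -> is_derive t 1 u (field_in c (u t)) ->
  integral_at (chart_inv c \o u) t.
Proof.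
move=> ac cut du.
have cu := is_derive_continuous du.
have cg : {for t, continuous (chart_inv c \o u)}.
  by apply: continuous_comp cu _; exact: chart_inv_continuous.
split=> //.
have cx := chart_inv_dom cut.
have ne : \forall s \near t, u s = (chart_fun c \o (chart_inv c \o u)) s.
  have h : \forall s \near t, chart_cod c (u s) := cu _ (near_chart_cod cut).
  by apply: filterS h => s cs /=; rewrite chart_invK.
have du' := near_eq_is_derive ne du.
have D := is_derive_chart_change ac (atlas_chart_at _) cg cx (mem_chart_at _) du'.
set x := chart_inv c (u t) in cx D *.
have E : 'd (transition c (chart_at x)) (chart_fun c x) (field_in c (u t)) = B x.
  by apply: diff_transitionK => //; [exact: atlas_chart_at|exact: mem_chart_at].
by rewrite /= -/x -E; exact: D.
Qed.

Lemma chart_field_lipschitz c x : atlas c -> chart_dom c x ->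
  exists r L K : R, [/\ 0 < r, 0 <= L, 0 <= K,
    forall p, `|p - chart_fun c x| <= r -> chart_cod c p /\ `|field_in c p| <= K &
    forall p q, `|p - chart_fun c x| <= r -> `|q - chart_fun c x| <= r ->
      `|field_in c p - field_in c q| <= L * `|p - q|].
Proof.
move=> ac cx; apply: C1_locally_lipschitz; first exact: open_chart_cod.
  exact: B_C1.
exact: mem_chart_cod.
Qed.

(** Agreement is a locally constant condition on the time. Where the curves differ, the Hausdorff
    property separates them nearby; where they meet, the short-time Gronwall estimate, applied in a
    chart to a difference vanishing at [t], keeps them equal. *)
Lemma integral_curve_unique g1 g2 (a b t0 : R) :
  (forall t, a < t < b -> integral_at g1 t) ->
  (forall t, a < t < b -> integral_at g2 t) ->
  a < t0 < b -> g1 t0 = g2 t0 -> forall t, a < t < b -> g1 t = g2 t.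
Proof.
move=> ig1 ig2 t0ab E; apply: (@interval_locally_constant R (fun t => g1 t = g2 t) a b t0) => // t tab.
have [cg1 _] := ig1 t tab; have [cg2 _] := ig2 t tab.
have [gt|gt] := pselect (g1 t = g2 t); last first.
  have := @manifold_hausdorff _ _ M; rewrite open_hausdorff => /(_ (g1 t) (g2 t)).
  case; first exact/eqP.
  move=> [U V] /= [/set_mem U1 /set_mem V2] [oU oV /eqP UV].
  have h1 : \forall s \near t, U (g1 s) by apply: cg1; exact: open_nbhs_nbhs.
  have h2 : \forall s \near t, V (g2 s) by apply: cg2; exact: open_nbhs_nbhs.
  apply: filterS2 h1 h2 => s Us Vs; split=> // gs.
  have : (U `&` V) (g1 s) by split=> //; rewrite gs.
  by rewrite UV.
pose c := chart_at (g1 t).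
have ac : atlas c by exact: atlas_chart_at.
have cd : chart_dom c (g1 t) by exact: mem_chart_at.
have [r [L [K [r0 L0 K0 rK rL]]]] := chart_field_lipschitz ac cd.
have near_g g : {for t, continuous g} -> g t = g1 t ->
    \forall s \near t, chart_dom c (g s) /\ `|chart_fun c (g s) - chart_fun c (g1 t)| <= r.
  move=> cg gE; have cgt : chart_dom c (g t) by rewrite gE.
  have h1 : \forall s \near t, chart_dom c (g s) := cg _ (near_chart_dom cgt).
  have cc : {for t, continuous (chart_fun c \o g)}.
    by apply: continuous_comp cg _; exact: chart_fun_continuous.
  have H : (chart_fun c \o g) @ t --> chart_fun c (g1 t) by rewrite -gE; exact: cc.
  have h2 : \forall s \near t, `|chart_fun c (g s) - chart_fun c (g1 t)| <= r.
    by move/cvgrPdistC_le : H => /(_ r r0).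
  exact: filterS2 h1 h2.
have near_ : \forall s \near t, a < s < b /\
    ((chart_dom c (g1 s) /\ `|chart_fun c (g1 s) - chart_fun c (g1 t)| <= r) /\
     (chart_dom c (g2 s) /\ `|chart_fun c (g2 s) - chart_fun c (g1 t)| <= r)).
  apply: filterI; first exact: near_itvoo.
  by apply: filterI; apply: near_g.
(* Radii below this value satisfy [rho * L <= 1/2], as the Gronwall estimate requires. *)
have e0 : 0 < (2 * (L + 1))^-1 by rewrite invr_gt0; lra.
have [rho [rho0 rhoe rhoP]] := near_closed_ball e0 near_.
have rhoL : rho * L <= 2^-1.
  apply: le_trans (_ : (2 * (L + 1))^-1 * (L + 1) <= _).
    by apply: ler_pM => //; [exact/ltW|lra].
  by rewrite invfM -mulrA mulVf ?mulr1//; lra.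
have sE s : `|s - t| <= rho -> g1 s = g2 s.
  move=> st; have [sab [[c1 _] [c2 _]]] := rhoP _ st.
  apply: (chart_at_inj c1 c2); apply/eqP; rewrite -subr_eq0 -normr_le0.
  have := @short_time_gronwall R n (fun s => chart_fun c (g1 s) - chart_fun c (g2 s))
    (fun s => field_in c (chart_fun c (g1 s)) - field_in c (chart_fun c (g2 s))) t rho L s L0 rhoL.
  rewrite /= gt subrr normr0 mulr0 subr0; apply=> // s' s't;
    have [s'ab [[c1' r1'] [c2' r2']]] := rhoP _ s't.
    by apply: is_deriveB; apply: integral_at_chart; [..|exact: ig1| | |exact: ig2].
  exact: rL.
have : \forall s \near t, `|s - t| <= rho.
  have H : (fun s : R => s) @ t --> t by exact: cvg_id.
  by move/cvgrPdistC_le : H => /(_ rho rho0).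
by apply: filterS => s /sE ->.
Qed.

Lemma integral_curveP (a b : R) g : integral_curve B `]a, b[ g <->
  forall t, a < t < b -> integral_at g t.
Proof.
by split=> H t tab; apply: H; move: tab; rewrite /= in_itv.
Qed.

Lemma flow_rel_unique (t : R) x y z : flow_rel B t x y -> flow_rel B t x z -> y = z.
Proof.
move=> [a1 [b1 [g1 [ab1 t1 /integral_curveP i1 x1 <-]]]].
move=> [a2 [b2 [g2 [ab2 t2 /integral_curveP i2 x2 <-]]]].
have sub s : Num.max a1 a2 < s < Num.min b1 b2 -> a1 < s < b1 /\ a2 < s < b2.
  by rewrite gt_max lt_min => /andP[/andP[-> ->] /andP[-> ->]].
apply: (@integral_curve_unique g1 g2 (Num.max a1 a2) (Num.min b1 b2) 0).
- by move=> s /sub[+ _]; exact: i1.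
- by move=> s /sub[_ +]; exact: i2.
- rewrite gt_max lt_min; lra.
- by rewrite x1.
- rewrite gt_max lt_min; lra.
Qed.

Lemma flowE (t : R) x y : flow_rel B t x y -> flow B t x = y.
Proof.
move=> xy; apply: (@flow_rel_unique t x) => //; rewrite /flow.
by case: xgetP => [z -> //|/(_ y)].
Qed.

Lemma flow_defined_rel (t : R) x : flow_defined B t x -> flow_rel B t x (flow B t x).
Proof. by move=> [y xy]; rewrite (flowE xy). Qed.

Lemma flow0 x : flow B 0 x = x.
Proof.
by rewrite /flow; case: xgetP => // y _ [a [b [g [_ _ _ <- <-]]]].
Qed.

(** The first curve and the second delayed by [t] meet at time [t]; by uniqueness they agree on the
    overlap of their intervals and glue to one integral curve on the union. *)
Lemma flow_rel_add (t s : R) x y z :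
  flow_rel B t x y -> flow_rel B s y z -> flow_rel B (t + s) x z.
Proof.
move=> [a1 [b1 [g1 [ab1 t1 /integral_curveP i1 x1 y1]]]].
move=> [a2 [b2 [g2 [ab2 s2 /integral_curveP i2 y2 z2]]]].
have agree r : a1 < r < b1 -> a2 < r - t < b2 -> g1 r = g2 (r - t).
  move=> r1 r2.
  apply: (@integral_curve_unique g1 (fun r => g2 (r - t))
    (Num.max a1 (a2 + t)) (Num.min b1 (b2 + t)) t).
  - by move=> r'; rewrite gt_max lt_min => ?; apply: i1; lra.
  - move=> r'; rewrite gt_max lt_min => ?.
    by apply: integral_at_shift; apply: i2; lra.
  - rewrite gt_max lt_min; lra.
  - by rewrite subrr y1 y2.
  - rewrite gt_max lt_min; lra.
pose h r := if a1 < r < b1 then g1 r else g2 (r - t).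
have h2 r : a2 < r - t < b2 -> h r = g2 (r - t).
  by rewrite /h; case: ifPn => // r1 r2; exact: agree.
exists (Num.min a1 (a2 + t)), (Num.max b1 (b2 + t)), h; split.
- rewrite gt_min lt_max; lra.
- rewrite gt_min lt_max; lra.
- apply/integral_curveP => r; rewrite gt_min lt_max => rab.
  have [r1|r1] := boolP (a1 < r < b1).
    apply: integral_at_near (i1 _ r1); apply: filterS (near_itvoo r1) => r' r1'.
    by rewrite /h r1'.
  have r2 : a2 + t < r < b2 + t by move: r1; rewrite negb_and -!leNgt; lra.
  have r2' : a2 < r - t < b2 by lra.
  apply: integral_at_near (integral_at_shift (i2 _ r2')).
  by apply: filterS (near_itvoo r2) => r' r2''; rewrite h2//; lra.
- by rewrite /h ab1.
- by rewrite h2 (addrC t) addrK.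
Qed.

Lemma flow_add (t s : R) x : flow_defined B t x -> flow_defined B s (flow B t x) ->
  flow_defined B (t + s) x /\ flow B (t + s) x = flow B s (flow B t x).
Proof.
move=> /flow_defined_rel tx /flow_defined_rel sx.
have H := flow_rel_add tx sx; split; first by eexists; exact: H.
exact: flowE.
Qed.

Lemma flow_curve g (a b t : R) : (forall t, a < t < b -> integral_at g t) ->
  a < 0 < b -> a < t < b -> flow_defined B t (g 0) /\ flow B t (g 0) = g t.
Proof.
move=> ig ab0 tab.
have H : flow_rel B t (g 0) (g t).
  by exists a, b, g; split => //; apply/integral_curveP.
by split; [exists (g t)|exact: flowE].
Qed.

(** A single time [e] serves all starting points in the neighbourhood [W]. The last estimate,
    Gronwall for the difference of two solutions, says that the time-[s] flow is close to the
    identity on differences; it gives continuity of the flow in the point and later continuity of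
    its derivative in time. *)
Lemma local_flow c x1 : atlas c -> chart_dom c x1 ->
  exists (e C : R) (W : set M),
  [/\ 0 < e, W x1, (forall z, W z -> chart_dom c z /\ \forall y \near z, W y),
    (forall z s, W z -> `|s| < e ->
       flow_defined B s z /\ chart_dom c (flow B s z)) &
    (forall z z' s, W z -> W z' -> `|s| < e ->
       `|(chart_fun c (flow B s z) - chart_fun c (flow B s z')) -
         (chart_fun c z - chart_fun c z')| <=
       C * `|s| * `|chart_fun c z - chart_fun c z'|)].
Proof.
move=> ac cx1.
have [r [L [K [r0 L0 K0 rK rL]]]] := chart_field_lipschitz ac cx1.
have [||e [e0 eL sol]] := @local_ode_solution R n (field_in c) (chart_fun c x1) r L K r0 L0 K0.
- by move=> p /rK[].
- by [].
pose W z := chart_dom c z /\ `|chart_fun c z - chart_fun c x1| < r / 2.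
have curve z : W z -> exists u : R -> 'rV[R]_n, u 0 = chart_fun c z /\
    forall s : R, `|s| <= e -> [/\ is_derive s 1 u (field_in c (u s)),
      `|u s - chart_fun c x1| <= r &
      `|s| < e -> [/\ flow_defined B s z, chart_dom c (flow B s z) &
        chart_fun c (flow B s z) = u s]].
  move=> [cz /ltW /sol[u [u0 du]]]; exists u; split=> // s se.
  have [us dus] := du s se; split=> // se'.
  have [] := @flow_curve (chart_inv c \o u) (- e) e s.
  - move=> t te; have [|ut dut] := du t.
      by rewrite ler_norml; case/andP: te => /ltW-> /ltW->.
    by apply: integral_at_of_chart => //; have [] := rK _ ut.
  - lra.
  - by rewrite -ltr_norml.
  rewrite /= u0 chart_funK// => fd ->; have [cus _] := rK _ us.
  by rewrite chart_invK//; split=> //; exact: chart_inv_dom.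
exists e, (2 * L), W; split=> //.
- by split=> //; rewrite subrr normr0 divr_gt0.
- move=> z [cz zr]; split=> //.
  have cc : chart_fun c @ z --> chart_fun c z by exact: chart_fun_continuous.
  have H : (fun y => `|chart_fun c y - chart_fun c x1|) @ z --> `|chart_fun c z - chart_fun c x1|.
    by apply: cvg_norm; apply: cvgB; [exact: cc|exact: cvg_cst].
  by apply: filterS2 (near_chart_dom cz) (cvgr_lt _ H _ zr) => y ? ?; split.
- by move=> z s /curve[u [_ H]] se; have [_ _ /(_ se)[]] := H s (ltW se).
move=> z z' s /curve[u [u0 du]] /curve[v [v0 dv]] se.
have [_ _ /(_ se)[_ _ ->]] := du s (ltW se).
have [_ _ /(_ se)[_ _ ->]] := dv s (ltW se).
have := @short_time_gronwall R n (fun s => u s - v s)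
  (fun s => field_in c (u s) - field_in c (v s)) 0 e L s L0 eL.
rewrite subr0 u0 v0; apply; last exact: ltW.
- by move=> t; rewrite subr0 => te; have [? _ _] := du t te; have [? _ _] := dv t te; exact: is_deriveB.
- by move=> t; rewrite subr0 => te; have [_ ? _] := du t te; have [_ ? _] := dv t te; exact: rL.
Qed.

Lemma local_flow_continuous c (e C s : R) (W : set M) z :
  (forall z, W z -> chart_dom c z /\ \forall y \near z, W y) ->
  (forall z s, W z -> `|s| < e ->
     flow_defined B s z /\ chart_dom c (flow B s z)) ->
  (forall z z' s, W z -> W z' -> `|s| < e ->
     `|(chart_fun c (flow B s z) - chart_fun c (flow B s z')) -
       (chart_fun c z - chart_fun c z')| <=
     C * `|s| * `|chart_fun c z - chart_fun c z'|) ->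
  W z -> `|s| < e -> {for z, continuous (flow B s)}.
Proof.
move=> Wn Wf Wg Wz se; have [cz nW] := Wn z Wz; have [fz cfz] := Wf z s Wz se.
have cc : chart_fun c @ z --> chart_fun c z by exact: chart_fun_continuous.
have cfc : (chart_fun c \o flow B s) @ z --> chart_fun c (flow B s z).
  apply/cvgrPdist_le => eps eps0.
  have C1 : 0 < `|C * `|s| | + 1 by rewrite ltr_pwDr.
  have /cvgrPdist_le/(_ (eps / (`|C * `|s| | + 1 + 1))) := cc.
  have C2 : 0 < `|C * `|s| | + 1 + 1 by lra.
  rewrite divr_gt0// => /(_ isT); apply: filterS2 nW => y Wy.
  rewrite ler_pdivlMr// => h /=.
  have h1 := Wg z y s Wz Wy se.
  have := lerB_dist (chart_fun c (flow B s z) - chart_fun c (flow B s y)) (chart_fun c z - chart_fun c y).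
  set A := `|chart_fun c (flow B s z) - _| in h1 *.
  set D := `|chart_fun c z - chart_fun c y| in h h1 *.
  have : C * `|s| * D <= `|C * `|s| | * D.
    by apply: ler_wpM2r; [rewrite /D|exact: ler_norm].
  have : D * (`|C * `|s| | + 1 + 1) = `|C * `|s| | * D + D + D by ring.
  have : 0 <= D by rewrite /D.
  lra.
have ci : {for chart_fun c (flow B s z), continuous (chart_inv c)}.
  by apply: chart_inv_continuous; exact: mem_chart_cod.
have H : (chart_inv c \o (chart_fun c \o flow B s)) @ z --> flow B s z.
  by rewrite -[X in _ --> X](chart_funK cfz); exact: continuous_cvg ci cfc.
apply: cvg_trans H; apply: near_eq_cvg; apply: filterS nW => y Wy /=.
by have [_ cfy] := Wf y s Wy se; rewrite chart_funK.
Qed.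

(** For small times this is the local flow; longer times are reached by composing with local flows
    along the fieldline. *)
Lemma flow_open g (a b : R) : (forall t, a < t < b -> integral_at g t) ->
  a < 0 < b -> forall t, a < t < b ->
  (\forall y \near g 0, flow_defined B t y) /\ {for g 0, continuous (flow B t)}.
Proof.
move=> ig ab0.
apply: (@interval_locally_constant R (fun t =>
  (\forall y \near g 0, flow_defined B t y) /\ {for g 0, continuous (flow B t)}) a b 0) => //;
  last first.
  have [e [C [W [e0 Wx Wn Wf Wg]]]] := local_flow (atlas_chart_at (g 0)) (mem_chart_at (g 0)).
  have s0 : `|0 : R| < e by rewrite normr0.
  split; last exact: local_flow_continuous Wn Wf Wg Wx s0.
  by have [_] := Wn _ Wx; apply: filterS => y Wy; have [] := Wf y 0 Wy s0.
move=> t1 t1ab.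
have [e [C [W [e0 Wx Wn Wf Wg]]]] := local_flow (atlas_chart_at (g t1)) (mem_chart_at (g t1)).
have [cg _] := ig _ t1ab.
have Wg1 : \forall t \near t1, W (g t) by have [_ nW] := Wn _ Wx; exact: cg _ nW.
(* Composition with the flow of time [t' - t] passes the property from [t] to [t']. Since [e] is
   uniform on [W], this works both from [t1] to [s] and from [s] to [t1], which gives the
   equivalence. *)
have step t t' : a < t < b -> W (g t) -> `|t' - t| < e ->
   (\forall y \near g 0, flow_defined B t y) /\ {for g 0, continuous (flow B t)} ->
   (\forall y \near g 0, flow_defined B t' y) /\ {for g 0, continuous (flow B t')}.
  move=> tab Wgt t'e [fd fc].
  have [_ ft] := flow_curve ig ab0 tab.
  have Wft : W (flow B t (g 0)) by rewrite ft.
  have nW : \forall y \near g 0, W (flow B t y) by have [_ nW] := Wn _ Wft; exact: fc _ nW.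
  have add : \forall y \near g 0, flow_defined B t' y /\ flow B t' y = flow B (t' - t) (flow B t y).
    apply: filterS2 fd nW => y fdy Wy; have [fd' _] := Wf _ _ Wy t'e.
    by have [] := flow_add fdy fd'; rewrite subrKC.
  split; first by apply: filterS add => y [].
  have cc : {for g 0, continuous (flow B (t' - t) \o flow B t)}.
    by apply: continuous_comp fc _; exact: local_flow_continuous Wn Wf Wg Wft t'e.
  have [_ E0] := nbhs_singleton add.
  suff : flow B t' @ g 0 --> flow B t' (g 0) by [].
  by rewrite E0; apply: cvg_trans cc; apply: near_eq_cvg; apply: filterS add => y [].
have near_e : \forall s \near t1, `|s - t1| < e.
  have H : (fun s : R => s) @ t1 --> t1 by exact: cvg_id.
  by move/cvgrPdistC_lt : H => /(_ e e0).
apply: filterS2 (filterI Wg1 (near_itvoo t1ab)) near_e => s [Ws sab] se.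
by split; apply: step => //; rewrite distrC.
Qed.

End Flow.

(** * Trilinear alternating forms and estimates on differentials *)
Section Trilinear.
Variable R : realType.

Definition trilinear_alternating (w : 'rV[R]_3 -> 'rV[R]_3 -> 'rV[R]_3 -> R) :=
  (forall u v, [/\ scalar (fun a : 'rV[R]_3 => w a u v),
    scalar (fun a : 'rV[R]_3 => w u a v) & scalar (fun a : 'rV[R]_3 => w u v a)]) /\
  (forall u v, [/\ w u u v = 0, w u v u = 0 & w v u u = 0]).

Let i0 : 'I_3 := @Ordinal 3 0 isT.
Let i1 : 'I_3 := @Ordinal 3 1 isT.
Let i2 : 'I_3 := @Ordinal 3 2 isT.
Let e (i : 'I_3) : 'rV[R]_3 := delta_mx 0 i.

Definition det3 (a b c : 'rV[R]_3) : R :=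
  a 0 i0 * (b 0 i1 * c 0 i2 - b 0 i2 * c 0 i1) -
  a 0 i1 * (b 0 i0 * c 0 i2 - b 0 i2 * c 0 i0) +
  a 0 i2 * (b 0 i0 * c 0 i1 - b 0 i1 * c 0 i0).

(** Alternating trilinear forms in dimension three form a line spanned by the determinant.
    Identities between values of such a form thus become polynomial identities in coordinates. *)
Lemma trilinear_det w : trilinear_alternating w ->
  forall a b c, w a b c = w (e i0) (e i1) (e i2) * det3 a b c.
Proof.
move=> [lin alt].
have expand f : scalar f -> forall u : 'rV[R]_3,
    f u = u 0 i0 * f (e i0) + u 0 i1 * f (e i1) + u 0 i2 * f (e i2).
  move=> fl u.
  have f0 : f 0 = 0.
    by have := fl (-1) 0 0; rewrite scaler0 addr0; move=> /= h; lra.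
  have -> : f u = f (u 0 i0 *: e i0 + (u 0 i1 *: e i1 + (u 0 i2 *: e i2 + 0))).
    congr (f _); apply/rowP => -[[|[|[|//]]] lt]; rewrite !mxE /=;
      rewrite mulr1 !mulr0 ?addr0 ?add0r; congr (u _ _); exact/val_inj.
  by rewrite !fl f0; ring.
have l1 u v := let: And3 h _ _ := lin u v in h.
have l2 u v := let: And3 _ h _ := lin u v in h.
have l3 u v := let: And3 _ _ h := lin u v in h.
have a12 u v : w u u v = 0 by have [] := alt u v.
have a13 u v : w u v u = 0 by have [] := alt u v.
have a23 u v : w v u u = 0 by have [] := alt u v.
have s12 u v x : w u v x = - w v u x.
  have := a12 (1 *: u + v) x.
  rewrite (l1 (1 *: u + v) x 1 u v) (l2 u x 1 u v) (l2 v x 1 u v) !a12; lra.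
have s23 u v x : w u v x = - w u x v.
  have := a23 (1 *: v + x) u.
  rewrite (l2 u (1 *: v + x) 1 v x) (l3 u v 1 v x) (l3 u x 1 v x) !a23; lra.
move=> a b c.
rewrite (expand _ (l1 b c) a).
rewrite (expand _ (l2 (e i0) c) b) (expand _ (l2 (e i1) c) b) (expand _ (l2 (e i2) c) b).
rewrite (expand _ (l3 (e i0) (e i0)) c) (expand _ (l3 (e i0) (e i1)) c)
  (expand _ (l3 (e i0) (e i2)) c) (expand _ (l3 (e i1) (e i0)) c)
  (expand _ (l3 (e i1) (e i1)) c) (expand _ (l3 (e i1) (e i2)) c)
  (expand _ (l3 (e i2) (e i0)) c) (expand _ (l3 (e i2) (e i1)) c)
  (expand _ (l3 (e i2) (e i2)) c).
rewrite !a12 !a13 !a23.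
rewrite (s12 (e i1) (e i0) (e i2)) (s23 (e i0) (e i2) (e i1)).
rewrite (s12 (e i2) (e i0) (e i1)) (s23 (e i0) (e i2) (e i1)).
rewrite (s23 (e i1) (e i2) (e i0)) (s12 (e i1) (e i0) (e i2)).
rewrite (s12 (e i2) (e i1) (e i0)) (s23 (e i1) (e i2) (e i0)) (s12 (e i1) (e i0) (e i2)).
by rewrite /det3; ring.
Qed.

Lemma trilinear_cycle w : trilinear_alternating w ->
  forall a b c, w a b c = w b c a.
Proof.
move=> tw a b c.
by rewrite (trilinear_det tw a b c) (trilinear_det tw b c a) /det3; ring.
Qed.

(** Cramer's rule without division, so it also holds for dependent [a], [b], [c]. *)
Lemma cramer3 w : trilinear_alternating w -> forall a b c x,
  w a b c *: x = w x b c *: a + w a x c *: b + w a b x *: c.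
Proof.
move=> tw a b c x; apply/rowP => j.
rewrite !(trilinear_det tw a b c, trilinear_det tw x b c, trilinear_det tw a x c,
  trilinear_det tw a b x) /det3 !mxE.
have : j = i0 \/ j = i1 \/ j = i2.
  by case: j => -[|[|[|//]]] lt; [left|right; left|right; right]; exact/val_inj.
by case=> [|[]] ->; ring.
Qed.

(** The form at [t] is a scalar coefficient times the determinant, so continuity of that coefficient
    suffices for the form, and the determinant is polynomial in the entries. *)
Lemma trilinear_continuous (T : topologicalType) (t0 : T)
    (w : T -> 'rV[R]_3 -> 'rV[R]_3 -> 'rV[R]_3 -> R) (a b c : T -> 'rV[R]_3) :
  (forall t, trilinear_alternating (w t)) ->
  (forall u v x, (fun t => w t u v x) @ t0 --> w t0 u v x) ->
  a @ t0 --> a t0 -> b @ t0 --> b t0 -> c @ t0 --> c t0 ->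
  (fun t => w t (a t) (b t) (c t)) @ t0 --> w t0 (a t0) (b t0) (c t0).
Proof.
move=> tw cw ca cb cc.
have entry (f : T -> 'rV[R]_3) i : f @ t0 --> f t0 -> (fun t => f t 0 i) @ t0 --> f t0 0 i.
  move=> cf; apply: (@continuous_cvg _ _ _ _ _ f (fun v : 'rV[R]_3 => v 0 i)) cf.
  apply: (@lipschitz_continuous R 'rV[R]_3 R (fun v => v 0 i) 1) => x y; rewrite mul1r.
  by have := norm_entry (x - y) i; rewrite !mxE.
have -> : (fun t => w t (a t) (b t) (c t)) =
    (fun t => w t (e i0) (e i1) (e i2) * det3 (a t) (b t) (c t)).
  by apply/funext => t; rewrite (trilinear_det (tw t)).
rewrite (trilinear_det (tw t0)); apply: cvgM; first exact: cw.
have A i := entry a i ca; have B i := entry b i cb; have C i := entry c i cc.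
have minor i j : (fun t => b t 0 i * c t 0 j - b t 0 j * c t 0 i) @ t0 -->
    b t0 0 i * c t0 0 j - b t0 0 j * c t0 0 i.
  by apply: cvgB; apply: cvgM; [exact: B|exact: C|exact: B|exact: C].
apply: cvgD; first apply: cvgB.
- by apply: cvgM; [exact: A|exact: minor].
- by apply: cvgM; [exact: A|exact: minor].
- by apply: cvgM; [exact: A|exact: minor].
Qed.

End Trilinear.

Section DiffEstimates.
Variable R : realType.

Lemma diff_eq0 (V W : normedModType R) (f : V -> W) x v :
  ~ differentiable f x -> 'd f x v = 0.
Proof.
move=> ndf; rewrite /diff; set Q := (Q in get Q).
case: (pselect (exists df, Q df)) => [/getPex Qd|nQ].
  by exfalso; apply: ndf; apply/diffP; exact: Qd.
by rewrite xgetPN// => df Qdf; apply: nQ; exists df.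
Qed.

Lemma diff_quotient_cvg (V W : normedModType R) (f : V -> W) x v :
  differentiable f x ->
  (fun h : R => h^-1 *: (f (h *: v + x) - f x)) @ 0^' --> 'd f x v.
Proof.
by move=> df; rewrite -deriveE//; have := @diff_derivable _ _ _ f x v df; exact.
Qed.

(** An inequality between increments, homogeneous of degree one, passes to difference quotients and
    then to their limits. It is applied with [f] and [g] the flows at two nearby times. *)
Lemma diff_estimate (V W : normedModType R) (f g : V -> W) x K v :
  differentiable f x -> differentiable g x ->
  (\forall y \near x, `|(f y - f x) - (g y - g x)| <= K * `|g y - g x|) ->
  `|'d f x v - 'd g x v| <= K * `|'d g x v|.
Proof.
move=> df dg fg.
have qf := diff_quotient_cvg (v := v) df; have qg := diff_quotient_cvg (v := v) dg.
suff H : \forall h \near (0 : R)^',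
    `|h^-1 *: (f (h *: v + x) - f x) - h^-1 *: (g (h *: v + x) - g x)| <=
    K * `|h^-1 *: (g (h *: v + x) - g x)|.
  apply: (ler_cvg_to _ _ H); first by apply: cvg_norm; apply: cvgB.
  by apply: cvgM; [exact: cvg_cst|exact: cvg_norm].
have near0 : \forall h \near (0 : R),
   `|(f (h *: v + x) - f x) - (g (h *: v + x) - g x)| <= K * `|g (h *: v + x) - g x|.
  have c : (fun h : R => h *: v + x) @ (0 : R) --> x.
    rewrite -[X in _ --> X]add0r -[X in _ --> X + _](scale0r v).
    by apply: cvgD; [apply: cvgZr_tmp; exact: cvg_id|exact: cvg_cst].
  exact: c _ fg.
apply/cvg_within; apply: filterS near0 => h /= hP.
by rewrite -scalerBr !normrZ mulrCA ler_wpM2l.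
Qed.

Lemma linear_left_inverse n m (f : {linear 'rV[R]_n -> 'rV[R]_m}) :
  (forall v, f v = 0 -> v = 0) ->
  exists g : {linear 'rV[R]_m -> 'rV[R]_n}, forall v, g (f v) = v.
Proof.
move=> f0; have fr : row_free (lin1_mx f).
  by apply: inj_row_free => v; rewrite mul_rV_lin1; exact: f0.
exists (mulmxr (pinvmx (lin1_mx f))) => v.
by rewrite /= -mul_rV_lin1 -mulmxA mulmxVp// mulmx1.
Qed.

End DiffEstimates.

(** * Derivative of the flow and curves on a torus *)
Section FlowDerivative.
Variables (R : realType) (n : nat) (M : manifold R n) (B : vector_field M).
Hypothesis B_C1 : C1_field B.
Variables (g : R -> M) (a b : R).
Hypothesis ig : forall t : R, a < t < b -> integral_at B g t.
Hypothesis ab0 : a < 0 < b.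

Let x0 := g 0.
Let c0 := chart_at x0.
Let p0 := chart_fun c0 x0.

Lemma chart_inv_at : chart_inv c0 p0 = x0.
Proof. by rewrite chart_funK//; exact: mem_chart_at. Qed.

Lemma chart_inv_at_continuous : {for p0, continuous (chart_inv c0)}.
Proof. by apply: chart_inv_continuous; apply: mem_chart_cod; exact: mem_chart_at. Qed.

Lemma flow_chart_continuous (t : R) : a < t < b ->
  {for p0, continuous (flow B t \o chart_inv c0)}.
Proof.
move=> tab; apply: continuous_comp chart_inv_at_continuous _.
by rewrite chart_inv_at; have [] := flow_open B_C1 ig ab0 tab.
Qed.

Lemma flow_chart_at (t : R) : a < t < b -> (flow B t \o chart_inv c0) p0 = g t.
Proof. by move=> tab; rewrite /= chart_inv_at; have [] := flow_curve B_C1 ig ab0 tab. Qed.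

Hypothesis flow_diff : forall t, a < t < b ->
  differentiable (chart_fun (chart_at (g t)) \o (flow B t \o chart_inv c0)) p0.

Lemma flow_chart_diff c (t : R) : atlas c -> a < t < b -> chart_dom c (g t) ->
  differentiable (chart_fun c \o (flow B t \o chart_inv c0)) p0 /\
  forall v, 'd (chart_fun c \o (flow B t \o chart_inv c0)) p0 v =
    'd (transition (chart_at (g t)) c) (chart_fun (chart_at (g t)) (g t))
      ('d (chart_fun (chart_at (g t)) \o (flow B t \o chart_inv c0)) p0 v).
Proof.
move=> ac tab ct; have E := flow_chart_at tab.
have := @diff_chart_change _ _ _ _ (flow B t \o chart_inv c0) p0 (chart_at (g t)) c
  (atlas_chart_at _) ac (flow_chart_continuous tab).
by rewrite E; apply => //; [exact: mem_chart_at|exact: flow_diff].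
Qed.

Lemma flow_derivative_continuous c (t1 : R) v : atlas c -> a < t1 < b ->
  chart_dom c (g t1) ->
  (fun t => 'd (chart_fun c \o (flow B t \o chart_inv c0)) p0 v) @ t1 -->
  'd (chart_fun c \o (flow B t1 \o chart_inv c0)) p0 v.
Proof.
move=> ac t1ab ct1.
have [e [C [W [e0 Wx Wn Wf Wg]]]] := local_flow B_C1 ac ct1.
have [cg _] := ig t1ab.
have nW : \forall t \near t1, W (g t) by have [_ nW] := Wn _ Wx; exact: cg _ nW.
have near_e : \forall s \near t1, `|s - t1| < e.
  have H : (fun s : R => s) @ t1 --> t1 by exact: cvg_id.
  by move/cvgrPdistC_lt : H => /(_ e e0).
have [df1 _] := flow_chart_diff ac t1ab ct1.
have [fd1 fc1] := flow_open B_C1 ig ab0 t1ab.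
have [_ f1] := flow_curve B_C1 ig ab0 t1ab.
pose D t := 'd (chart_fun c \o (flow B t \o chart_inv c0)) p0 v.
have est t : W (g t) -> a < t < b -> `|t - t1| < e ->
    `|D t - D t1| <= C * `|t - t1| * `|D t1|.
  move=> Wt tab te; have [ct _] := Wn _ Wt.
  have [df _] := flow_chart_diff ac tab ct.
  apply: diff_estimate df df1 _.
  have W1 : W (flow B t1 x0) by rewrite f1.
  (* Near [x0] the flow of time [t] factors through that of time [t1], so the local flow estimate
     compares the two maps with constant [C * |t - t1|]. *)
  have add y : flow_defined B t1 y -> W (flow B t1 y) ->
      flow B t y = flow B (t - t1) (flow B t1 y).
    move=> fdy Wy; have [fd' _] := Wf _ _ Wy te.
    by have [_] := flow_add B_C1 fdy fd'; rewrite subrKC.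
  have near_x0 : \forall y \near x0, flow_defined B t1 y /\ W (flow B t1 y).
    by have [_ nW1] := Wn _ W1; apply: filterI; [exact: fd1|exact: fc1 _ nW1].
  have near_p0 : \forall q \near p0, flow_defined B t1 (chart_inv c0 q) /\
      W (flow B t1 (chart_inv c0 q)).
    have ci : chart_inv c0 @ p0 --> x0.
      by rewrite -[X in _ --> X]chart_inv_at; exact: chart_inv_at_continuous.
    exact: ci _ near_x0.
  apply: filterS near_p0 => q [fdq Wq].
  have [fdx _] := nbhs_singleton near_x0.
  by rewrite /= chart_inv_at (add _ fdq Wq) (add _ fdx W1); exact: Wg.
suff : D @ t1 --> D t1 by [].
apply/cvgrPdistC_le => eps eps0.
have K0 : 0 < `|C| * `|D t1| + 1 by rewrite ltr_wpDl// mulr_ge0.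
have near_eps : \forall s \near t1, `|s - t1| <= eps / (`|C| * `|D t1| + 1).
  have H : (fun s : R => s) @ t1 --> t1 by exact: cvg_id.
  by move/cvgrPdistC_le : H => /(_ _ (divr_gt0 eps0 K0)).
apply: filterS2 (filterI nW (near_itvoo t1ab)) (filterI near_e near_eps) => t [Wt tab] [te].
rewrite ler_pdivlMr// => teps; apply: le_trans (est t Wt tab te) _.
apply: le_trans teps; rewrite mulrDr mulr1 -[leLHS]addr0 lerD//.
by rewrite mulrAC mulrC ler_wpM2l// ler_wpM2r// ler_norm.
Qed.

(** The curve [s |-> phi_t (g s) = g (s + t)] is differentiated at [s = 0] in two ways: by the chain
    rule, and as an integral curve. *)
Lemma flow_derivative_field (t : R) : a < t < b ->
  'd (chart_fun (chart_at (g t)) \o (flow B t \o chart_inv c0)) p0 (B x0) = B (g t).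
Proof.
move=> tab.
have [cg0 dg0] := ig ab0.
have dfg := @is_derive_comp _ _ _ _ (chart_fun c0 \o g) 0 (B x0) (flow_diff tab) dg0.
have sh : integral_at B (fun s => g (s - (- t))) 0.
  by apply: integral_at_shift; rewrite opprK add0r; exact: ig.
have E : g (0 - - t) = g t by rewrite opprK add0r.
have [_ /=] := sh; rewrite E => dsh.
have ne : \forall s \near (0 : R), (chart_fun (chart_at (g t)) \o (fun s => g (s - - t))) s =
  ((chart_fun (chart_at (g t)) \o (flow B t \o chart_inv c0)) \o (chart_fun c0 \o g)) s.
  have h1 : \forall s \near (0 : R), chart_dom c0 (g s).
    by apply: cg0 _ (near_chart_dom _); exact: mem_chart_at.
  have ab0t : a - t < 0 < b - t by lra.
  apply: filterS2 h1 (filterI (near_itvoo ab0) (near_itvoo ab0t)) => s cs [sab sabt] /=.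
  rewrite chart_funK// opprK; congr chart_fun.
  have [|||_] := @flow_curve _ _ _ _ B_C1 (fun r => g (r - - s)) (a - s) (b - s) t.
  - by move=> r rab; apply: integral_at_shift; apply: ig; rewrite opprK; lra.
  - lra.
  - lra.
  - by rewrite !opprK add0r (addrC t).
have dd := near_eq_is_derive ne dsh.
by rewrite -(@derive_val _ _ _ _ _ _ _ dd) (@derive_val _ _ _ _ _ _ _ dfg).
Qed.

End FlowDerivative.

(** * Lifts to the universal cover and tangency of curves on an embedded torus *)

Section Torus.
Variables (R : realType) (n : nat) (M : manifold R n) (T : torus M).

(** Rounding the coordinates of [q0 - p] to nearest integers gives the period to add. *)
Lemma torus_translate (p q0 : 'rV[R]_2) : exists q : 'rV[R]_2,
  `|q - q0| <= 2^-1 /\ torus_map T q = torus_map T p.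
Proof.
pose k : 'rV[int]_2 := \row_i Num.floor (q0 0 i - p 0 i + 2^-1).
exists (p + map_mx intr k); split; last by apply/esym/torus_map_eq; exists k.
apply: norm_row_le => [|i]; first by rewrite invr_ge0.
rewrite !mxE ler_norml.
have /andP[h1 h2] := floor_itv (q0 0 i - p 0 i + 2^-1).
by rewrite intrD in h2; apply/andP; split; lra.
Qed.

(* Compactness of the part of the period square away from [q0], whose image
   avoids [torus_map T q0]. *)
Lemma torus_near (q0 : 'rV[R]_2) (delta : R) : 0 < delta ->
  \forall y \near torus_map T q0, forall q, `|q - q0| <= 2^-1 ->
    torus_map T q = y -> `|q - q0| < delta.
Proof.
move=> delta0.
pose K : set 'rV[R]_2 := (fun q => `|q - q0|) @^-1` `[delta, 2^-1]%classic.
have cnorm : continuous (fun q : 'rV[R]_2 => `|q - q0|).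
  apply: (@lipschitz_continuous R _ _ _ 1) => x y; rewrite mul1r.
  by apply: le_trans (ler_dist_dist _ _) _; rewrite opprB addrA subrK.
have cptK : compact K.
  apply: bounded_closed_compact.
    exists (`|q0| + 2^-1); split; first by rewrite num_real.
    move=> m hm q; rewrite /K/= in_itv/= => /andP[_ qq0].
    have := ler_normD (q - q0) q0; rewrite subrK => h.
    by apply: le_trans h _; lra.
  by apply: preimage_closed => [q _|]; [exact: cnorm|exact: interval_closed].
have clK : closed (torus_map T @` K).
  apply: compact_closed; first exact: manifold_hausdorff.
  apply: continuous_compact cptK; apply: continuous_subspaceT.
  exact: torus_map_continuous.
(* A point with the image of [q0] differs from it by an integer vector; within distance [1/2] that
   vector is zero, against [delta > 0]. *)
have nK : ~ (torus_map T @` K) (torus_map T q0).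
  move=> [q]; rewrite /K/= in_itv/= => /andP[dq q2] /esym/torus_map_eq[k qE].
  suff k0 : k = 0.
    by move: dq; rewrite qE k0 map_mx0 addr0 subrr normr0; lra.
  apply/rowP => i; rewrite mxE; apply/eqP; rewrite -normr_le0 -ltzD1 add0r.
  have : `|q 0 i - q0 0 i| <= 2^-1.
    by apply: le_trans q2; have := norm_entry (q - q0) i; rewrite !mxE.
  rewrite qE !mxE addrAC subrr add0r -intr_norm => h.
  by rewrite -(@ltr_int R); apply: le_lt_trans h _; rewrite invf_lt1//; lra.
have : \forall y \near torus_map T q0, (~` (torus_map T @` K)) y.
  by apply: open_nbhs_nbhs; split => //; exact: closed_openC.
apply: filterS => y nKy q q2 qy; rewrite ltNge; apply/negP => dq; apply: nKy.
by exists q => //; rewrite /K/= in_itv/= dq.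
Qed.

(** No differentiable lift of [f] is constructed. For each small [s] a lift [q] of [f s] near [q0]
    is picked, and a linear left inverse [P] of the differential bounds [q - q0] by the increment
    [U s]. Hence ['d F q0 (P (U s)) - U s] is negligible against [U s]; division by [s] shows that
    [P w] is a preimage of [w]. *)
Lemma torus_curve_tangent (f : R -> M) (q0 : 'rV[R]_2) (w : 'rV[R]_n) :
  torus_map T q0 = f 0 -> {for 0, continuous f} ->
  (\forall s \near (0 : R), torus_set T (f s)) ->
  is_derive (0 : R) 1 (chart_fun (chart_at (f 0)) \o f) w ->
  exists z, 'd (chart_fun (chart_at (f 0)) \o torus_map T) q0 z = w.
Proof.
move=> q0E cf fT df; set c := chart_at (f 0).
pose F := chart_fun c \o torus_map T.
have dF : differentiable F q0.
  have [+ _] := torus_map_C1 T (atlas_chart_at (f 0)).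
  by apply; rewrite /preimage/= q0E; exact: mem_chart_at.
have Linj v : 'd F q0 v = 0 -> v = 0.
  by move=> Fv; apply: (@torus_map_immersion _ _ _ T q0); rewrite q0E.
have [P PL] := linear_left_inverse Linj.
exists (P w); apply/eqP; rewrite -subr_eq0 -normr_le0.
set k := \sum_j `|P (delta_mx 0 j)|.
have Pk u : `|P u| <= k * `|u| by exact: linear_row_bound.
have k0 : 0 <= k by apply: sumr_ge0.
set l := \sum_j `|'d F q0 (delta_mx 0 j)|.
have Ll u : `|'d F q0 u| <= l * `|u| by exact: linear_row_bound.
have l0 : 0 <= l by apply: sumr_ge0.
pose U s := chart_fun c (f s) - chart_fun c (f 0).
have UG eps : 0 < eps -> eps * k <= 2^-1 ->
    \forall s \near (0 : R), `|'d F q0 (P (U s)) - U s| <= ((l * k + 1) * (2 * k * eps)) * `|U s|.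
  move=> eps0 epsk.
  have [d /= d0 dP] := (nbhs_ballP _ _).1 (diff_near0 dF eps0).
  have nq : \forall s \near (0 : R), forall q, `|q - q0| <= 2^-1 ->
      torus_map T q = f s -> `|q - q0| < d.
    by have nt := torus_near q0 d0; rewrite q0E in nt; exact: cf _ nt.
  apply: filterS2 fT nq => s [p _ ps] /(_ _ _ _) nqs.
  have [q [q2 qp]] := torus_translate p q0.
  have qd := nqs q q2 (etrans qp ps).
  set eta := q - q0 in qd.
  have := dP eta; rewrite -ball_normE /= sub0r normrN => /(_ qd).
  have -> : F (eta + q0) - F q0 = U s.
    by rewrite /F/= /eta subrK qp ps q0E.
  move=> h.
  (* Applying [P] gives [|eta| <= k * |U s| + eps * k * |eta|], and [eps * k <= 1/2] lets the last
     term be absorbed. *)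
  have heta : `|eta| <= 2 * k * `|U s|.
    have h1 : `|eta| <= k * `|'d F q0 eta| by rewrite -{1}(PL eta).
    have h2 : `|'d F q0 eta| <= `|U s| + eps * `|eta|.
      have := ler_normB (U s) (U s - 'd F q0 eta); rewrite opprB subrKC; lra.
    have h3 : k * `|'d F q0 eta| <= k * `|U s| + (eps * k) * `|eta|.
      by apply: le_trans (ler_wpM2l k0 h2) _; rewrite le_eqVlt; apply/orP; left; apply/eqP; ring.
    have h4 : (eps * k) * `|eta| <= 2^-1 * `|eta| by rewrite ler_wpM2r.
    lra.
  have h5 : `|U s - 'd F q0 eta| <= 2 * k * eps * `|U s|.
    apply: le_trans h _; rewrite [leRHS](_ : _ = eps * (2 * k * `|U s|)); last by ring.
    by rewrite ler_wpM2l// ltW.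
  (* ['d F q0 \o P] fixes ['d F q0 eta], so only the small remainder [U s - 'd F q0 eta]
     contributes. *)
  have -> : 'd F q0 (P (U s)) - U s =
      'd F q0 (P (U s - 'd F q0 eta)) - (U s - 'd F q0 eta).
    rewrite (linearB P (U s)) PL (linearB ('d F q0) (P (U s)) eta).
    move: ('d F q0 (P (U s))) ('d F q0 eta) => x y.
    by apply/rowP => i; rewrite !mxE; ring.
  apply: le_trans (ler_normB _ _) _.
  have h6 : `|'d F q0 (P (U s - 'd F q0 eta))| <= l * (k * `|U s - 'd F q0 eta|).
    by apply: le_trans (Ll _) _; rewrite ler_wpM2l.
  apply: le_trans (lerD h6 h5) _.
  have h7 : l * (k * `|U s - 'd F q0 eta|) <= l * (k * (2 * k * eps * `|U s|)).
    by rewrite ler_wpM2l// ler_wpM2l.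
  apply: le_trans (lerD h7 (lexx _)) _.
  by rewrite le_eqVlt; apply/orP; left; apply/eqP; ring.
have Uw : (fun s : R => s^-1 *: U s) @ 0^' --> w.
  have dd : derivable (chart_fun c \o f) 0 1 by exact: ex_derive.
  rewrite -(@derive_val _ _ _ _ _ _ _ df).
  apply: cvg_trans dd; apply: near_eq_cvg; near=> s.
  by rewrite /U /= /GRing.scale/= mulr1 addr0.
have Gw eps : 0 < eps -> eps * k <= 2^-1 ->
    `|'d F q0 (P w) - w| <= ((l * k + 1) * (2 * k * eps)) * `|w|.
  move=> eps0 epsk; have ne := UG eps eps0 epsk.
  have H : \forall s \near (0 : R)^', `|'d F q0 (P (s^-1 *: U s)) - s^-1 *: U s| <=
      ((l * k + 1) * (2 * k * eps)) * `|s^-1 *: U s|.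
    apply/cvg_within; apply: filterS ne => s hs.
    have -> : 'd F q0 (P (s^-1 *: U s)) = s^-1 *: 'd F q0 (P (U s)).
      by rewrite !linearZ.
    by rewrite -scalerBr !normrZ mulrCA ler_wpM2l.
  apply: (ler_cvg_to _ _ H).
    apply: cvg_norm; apply: cvgB; last exact: Uw.
    apply: (@continuous_cvg _ _ _ _ _ (fun s => s^-1 *: U s) ('d F q0 \o P)) Uw.
    by apply: continuous_comp; exact: linear_row_continuous.
  by apply: cvgM; [exact: cvg_cst|exact: cvg_norm].
apply/ler_addgt0Pr => eps eps0; rewrite add0r.
set A := (l * k + 1) * (2 * k) * `|w|.
have A0 : 0 <= A by rewrite !mulr_ge0// addr_ge0// mulr_ge0.
have [e [e0 ek eA]] := small_factor k0 A0 eps0.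
apply: le_trans (Gw e e0 ek) _; apply: le_trans eA.
by rewrite le_eqVlt; apply/orP; left; apply/eqP; rewrite /A; ring.
Unshelve. all: by end_near. Qed.

End Torus.

(** * Sign of the covector along an invariant torus *)
Lemma near_sign (R : realType) (f : R -> R) (s : R) : f @ s --> f s -> f s != 0 ->
  \forall r \near s, 0 < f r <-> 0 < f s.
Proof.
move=> cf; rewrite neq_lt => /orP[fs|fs].
  have : \forall r \near s, f r < 0 by apply: (cvgr_lt _ cf).
  by apply: filterS => r fr; split=> h; lra.
have : \forall r \near s, 0 < f r by apply: (cvgr_gt _ cf).
by apply: filterS => r fr; split.
Qed.

Section ConeField.
Variables (R : realType) (M : manifold R 3) (Omega : field3 M).
Variables (B xi : vector_field M).
Arguments Omega : clear implicits.
Hypothesis Omega_volume : volume_form Omega.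
Hypothesis B_C1 : C1_field B.
Hypothesis B_preserves : preserves B Omega.
Hypothesis xi_C1 : C1_field xi.

Lemma omega_trilinear (x : M) : trilinear_alternating (Omega x).
Proof. by have [[lin alt _] _] := Omega_volume; split; [exact: lin|exact: alt]. Qed.

(* A non-differentiable map has differential [0], which cannot preserve a
   nonzero volume. *)
Lemma flow_differentiable (t : R) (x : M) : flow_defined B t x ->
  differentiable (chart_fun (chart_at (flow B t x)) \o
    (flow B t \o chart_inv (chart_at x))) (chart_fun (chart_at x) x).
Proof.
move=> fd; apply: contrapT => nd; have [_ /(_ x)[u [v [w /eqP]]]] := Omega_volume.
rewrite -(B_preserves fd); apply.
have -> : tangent_map (flow B t) u = 0 by exact: diff_eq0.
by rewrite (trilinear_det (omega_trilinear _)) /det3 !mxE; ring.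
Qed.

Section Curve.
Variables (g : R -> M) (a b : R).
Hypothesis ig : forall t : R, a < t < b -> integral_at B g t.
Hypothesis ab0 : a < 0 < b.

Let x0 := g 0.
Let c0 := chart_at x0.
Let p0 := chart_fun c0 x0.
(** The derivative of the flow at [x0] in preferred charts, with the target chart taken at [g t]. *)
Let tau t := 'd (chart_fun (chart_at (g t)) \o (flow B t \o chart_inv c0)) p0.

Lemma curve_flow_differentiable (t : R) : a < t < b ->
  differentiable (chart_fun (chart_at (g t)) \o (flow B t \o chart_inv c0)) p0.
Proof.
move=> tab; have [fd fE] := flow_curve B_C1 ig ab0 tab.
by have := flow_differentiable fd; rewrite fE.
Qed.

Lemma fieldline_covectorE (t : R) (v : 'rV[R]_3) : a < t < b ->
  fieldline_covector Omega xi B t (v : tangent x0) =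
  Omega (g t) (xi (g t)) (B (g t)) (tau t v).
Proof.
move=> tab; have [fd fE] := flow_curve B_C1 ig ab0 tab.
by rewrite /fieldline_covector /tangent_map /x0 fE.
Qed.

Lemma preserves_curve (t : R) (u v w : 'rV[R]_3) : a < t < b ->
  Omega (g t) (tau t u) (tau t v) (tau t w) = Omega x0 u v w.
Proof.
move=> tab; have [fd fE] := flow_curve B_C1 ig ab0 tab.
by rewrite -(B_preserves fd) /tangent_map fE.
Qed.

Lemma tau_field (t : R) : a < t < b -> tau t (B x0) = B (g t).
Proof. by move=> tab; apply: (flow_derivative_field B_C1 ig ab0 _ tab); exact: curve_flow_differentiable. Qed.

Lemma tau0 v : tau 0 v = v.
Proof.
rewrite /tau (_ : _ \o _ = transition c0 c0); last first.
  by apply/funext => p; rewrite /transition /= flow0.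
by apply: diff_transition_id; exact: mem_chart_at.
Qed.

Lemma of_chartK (c : chart R 3 M) (x : M) (v : 'rV[R]_3) : atlas c -> chart_dom c x ->
  of_chart c (chart_fun c x)
    ('d (transition (chart_at x) c) (chart_fun (chart_at x) x) v) = v :> 'rV[R]_3.
Proof.
move=> ac cx; rewrite /of_chart chart_funK//.
by apply: diff_transitionK => //; [exact: atlas_chart_at|exact: mem_chart_at].
Qed.

Lemma field_in_continuous (X : vector_field M) (c : chart R 3 M) (x : M) : C1_field X -> atlas c ->
  chart_dom c x -> {for chart_fun c x, continuous (field_in X c)}.
Proof.
move=> XC1 ac cx; have [dX _] := XC1 c ac.
by apply: differentiable_continuous; apply: dX; exact: mem_chart_cod.
Qed.

(** The preferred chart at [g t] may jump with [t]. The covector is therefore rewritten in the one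
    chart [c] around [g t1], where the form, the two fields and the derivative of the flow all vary
    continuously. *)
Lemma fieldline_covector_continuous (t1 : R) (v : 'rV[R]_3) : a < t1 < b ->
  (fun t => fieldline_covector Omega xi B t (v : tangent x0)) @ t1 -->
  fieldline_covector Omega xi B t1 (v : tangent x0).
Proof.
move=> t1ab; have [cg _] := ig t1ab.
pose c := chart_at (g t1).
have ac : atlas c by exact: atlas_chart_at.
have ct1 : chart_dom c (g t1) by exact: mem_chart_at.
pose p t := chart_fun c (g t).
have cp : p @ t1 --> p t1.
  by apply: (@continuous_comp _ _ _ g (chart_fun c)) => //; exact: chart_fun_continuous.
(* [Om] and [oc] take all tangent vectors in the same space ['rV[R]_3], so that the base point can
   be replaced by an equal one. *)
pose Om (x : M) (u1 u2 u3 : 'rV[R]_3) : R := Omega x u1 u2 u3.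
pose oc t (u : 'rV[R]_3) : 'rV[R]_3 := of_chart c (p t) u.
pose w t (u1 u2 u3 : 'rV[R]_3) : R :=
  Om (chart_inv c (p t)) (oc t u1) (oc t u2) (oc t u3).
pose D t := 'd (chart_fun c \o (flow B t \o chart_inv c0)) p0 v.
have E t : a < t < b -> chart_dom c (g t) ->
    fieldline_covector Omega xi B t (v : tangent x0) =
    w t (field_in xi c (p t)) (field_in B c (p t)) (D t).
  move=> tab ct.
  have ocE (X : vector_field M) : oc t (field_in X c (p t)) = X (g t).
    by rewrite /oc /p field_inE; [exact: of_chartK|exact: ct].
  have [_ DE] := flow_chart_diff B_C1 ig ab0 curve_flow_differentiable ac tab ct.
  have ocD : oc t (D t) = tau t v.
    have DE' : D t = 'd (transition (chart_at (g t)) c)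
      (chart_fun (chart_at (g t)) (g t)) (tau t v) := DE v.
    by rewrite DE'; exact: (of_chartK (tau t v) ac ct).
  have pK : chart_inv c (p t) = g t by rewrite /p chart_funK.
  transitivity (Om (g t) (xi (g t)) (B (g t)) (tau t v)).
    exact: fieldline_covectorE.
  have Om_eq x x' (u1 u1' u2 u2' u3 u3' : 'rV[R]_3) : x = x' -> u1 = u1' ->
    u2 = u2' -> u3 = u3' -> Om x u1 u2 u3 = Om x' u1' u2' u3' by move=> -> -> -> ->.
  exact: (Om_eq _ _ _ _ _ _ _ _ (esym pK) (esym (ocE xi)) (esym (ocE B)) (esym ocD)).
have wt t : trilinear_alternating (w t).
  have [[lin alt _] _] := Omega_volume.
  split=> u1 u2; last by split;
    have [] := alt (chart_inv c (p t)) (of_chart c (p t) u1) (of_chart c (p t) u2).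
  have [l1 l2 l3] := lin (chart_inv c (p t)) (of_chart c (p t) u1) (of_chart c (p t) u2).
  have ocP k u u' : oc t (k *: u + u') = k *: oc t u + oc t u'.
    by rewrite /oc /of_chart linearP.
  split=> k x y; rewrite /w ocP; [exact: l1|exact: l2|exact: l3].
have wc u1 u2 u3 : (fun t => w t u1 u2 u3) @ t1 --> w t1 u1 u2 u3.
  have [[_ _ sm] _] := Omega_volume.
  have := sm c ac u1 u2 u3 0%N (p t1) (mem_chart_cod ct1).
  by move=> H; apply: (@continuous_cvg _ _ _ _ _ p _ _ H cp).
have H := @trilinear_continuous R R t1 w (fun t => field_in xi c (p t))
  (fun t => field_in B c (p t)) D wt wc.
rewrite E//.
have ne : \forall t \near t1, w t (field_in xi c (p t)) (field_in B c (p t)) (D t) =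
    fieldline_covector Omega xi B t (v : tangent x0).
  have h : \forall t \near t1, chart_dom c (g t) := cg _ (near_chart_dom ct1).
  by apply: filterS2 (near_itvoo t1ab) h => t tab ct; rewrite E.
apply: cvg_trans (near_eq_cvg ne) _; apply: H.
- by apply: (@continuous_cvg _ _ _ _ _ p _ _ _ cp); exact: field_in_continuous.
- by apply: (@continuous_cvg _ _ _ _ _ p _ _ _ cp); exact: field_in_continuous.
- by apply: (flow_derivative_continuous B_C1 ig ab0 curve_flow_differentiable).
Qed.

(** * Consequences of an invariant torus transverse to [xi] *)

Section InvariantTorus.
Variable T : torus M.
Hypothesis T_inv : flow_invariant B (torus_set T).
Hypothesis T_transverse : torus_transverse T xi.
Hypothesis Tx0 : torus_set T x0.

Lemma torus_flow (t : R) x : torus_set T x -> torus_set T (flow B t x).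
Proof.
move=> Tx; have [fd|nfd] := pselect (flow_defined B t x); first exact: T_inv.
(* Where the solution does not exist, [flow] returns its starting point, which is on the torus. *)
by rewrite /flow xgetPN// => y xy; apply: nfd; exists y.
Qed.

Lemma torus_curve (t : R) : a < t < b -> torus_set T (g t).
Proof.
by move=> tab; have [_ <-] := flow_curve B_C1 ig ab0 tab; exact: torus_flow.
Qed.

Lemma torus_tangent_field (t : R) q : a < t < b -> torus_map T q = g t ->
  exists z, 'd (chart_fun (chart_at (g t)) \o torus_map T) q z = B (g t).
Proof.
move=> tab qE.
pose f s := g (s - (- t)).
have f0 : f 0 = g t by rewrite /f opprK add0r.
have [cs ds] : integral_at B f 0.
  by apply: integral_at_shift; rewrite opprK add0r; exact: ig.
rewrite -f0; apply: torus_curve_tangent cs _ ds; first by rewrite f0.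
have abt : a - t < 0 < b - t by lra.
by apply: filterS (near_itvoo abt) => s sab; apply: torus_curve; rewrite opprK; lra.
Qed.

(** The flow moves the image of the line [q0 + s *: z] to a curve that stays on the torus by
    invariance; its velocity at [s = 0] is the right-hand side. *)
Lemma torus_tangent_flow (t : R) q q0 z : a < t < b -> torus_map T q = g t ->
  torus_map T q0 = x0 -> exists z',
  'd (chart_fun (chart_at (g t)) \o torus_map T) q z' =
  tau t ('d (chart_fun c0 \o torus_map T) q0 z).
Proof.
move=> tab qE q0E.
have [fd fE] := flow_curve B_C1 ig ab0 tab.
pose l (s : R) : 'rV[R]_2 := q0 + s *: z.
have l0 : l 0 = q0 by rewrite /l scale0r addr0.
have dl : is_derive (0 : R) 1 l z.
  exact: is_derive_segment.
have cl := is_derive_continuous dl.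
pose f s := flow B t (torus_map T (l s)).
have f0 : f 0 = g t by rewrite /f l0 q0E.
have cTl : {for 0, continuous (torus_map T \o l)}.
  by apply: continuous_comp cl _; exact: torus_map_continuous.
have cf : {for 0, continuous f}.
  apply: (@continuous_comp _ _ _ (torus_map T \o l) (flow B t)) => //.
  by rewrite /= l0 q0E; have [] := flow_open B_C1 ig ab0 tab.
have dT : differentiable (chart_fun c0 \o torus_map T) q0.
  have [+ _] := torus_map_C1 T (atlas_chart_at x0).
  by apply; rewrite /preimage/= q0E; exact: mem_chart_at.
have dTl : is_derive (0 : R) 1 ((chart_fun c0 \o torus_map T) \o l)
    ('d (chart_fun c0 \o torus_map T) q0 z).
  by have := @is_derive_comp _ _ _ (chart_fun c0 \o torus_map T) l 0 z; rewrite l0; apply.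
have pE : ((chart_fun c0 \o torus_map T) \o l) 0 = p0 by rewrite /= l0 q0E.
have df : is_derive (0 : R) 1 (chart_fun (chart_at (g t)) \o f)
    (tau t ('d (chart_fun c0 \o torus_map T) q0 z)).
  have := @is_derive_comp _ _ _ (chart_fun (chart_at (g t)) \o (flow B t \o chart_inv c0))
    ((chart_fun c0 \o torus_map T) \o l) 0 _ _ dTl.
  rewrite pE => /(_ (curve_flow_differentiable tab)); apply: near_eq_is_derive.
  have h : \forall s \near (0 : R), chart_dom c0 (torus_map T (l s)).
    apply: cTl _ (near_chart_dom _).
    by rewrite /= l0 q0E; exact: mem_chart_at.
  by apply: filterS h => s cs; rewrite /= chart_funK.
have := @torus_curve_tangent _ _ _ T f q (tau t ('d (chart_fun c0 \o torus_map T) q0 z)).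
rewrite f0; apply => //.
by near=> s; apply: torus_flow; exists (l s).
Unshelve. all: by end_near. Qed.

(** Cramer's rule for [xi (g t)] in the triple [tau t (xi x0)], [B (g t)], [tau t v], whose volume
    is [N] by preservation of [Omega]: if the covector vanished, the first coefficient would too,
    and [xi] would be a combination of two vectors tangent to the torus. *)
Lemma covector_neq0 (t : R) q0 z : a < t < b -> torus_map T q0 = x0 ->
  let v := 'd (chart_fun c0 \o torus_map T) q0 z in
  Omega x0 (xi x0) (B x0) v != 0 ->
  fieldline_covector Omega xi B t (v : tangent x0) != 0.
Proof.
move=> tab q0E v N0; rewrite fieldline_covectorE//; apply/eqP => cov0.
have Tgt := torus_curve tab; have [q _ qE] := Tgt.
have [zB zBE] := torus_tangent_field tab qE.
have [zv zvE] := torus_tangent_flow z tab qE q0E.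
have h := cramer3 (omega_trilinear (g t)) (tau t (xi x0)) (B (g t)) (tau t v) (xi (g t)).
rewrite cov0 scale0r add0r -{1}tau_field// preserves_curve// in h.
set N := Omega x0 _ _ _ in N0 h; set A1 := Omega _ _ (xi (g t)) _ in h.
set A2 := Omega _ _ _ (xi (g t)) in h.
have xiE : xi (g t) = N^-1 *: (A1 *: (B (g t) : 'rV[R]_3) + A2 *: tau t v) :> 'rV[R]_3.
  by rewrite -h scalerA mulVf// scale1r.
apply: (T_transverse Tgt).
exists q, (N^-1 *: (A1 *: zB + A2 *: zv)); split=> //.
by rewrite linearZ linearD !linearZ zBE zvE; exact: esym xiE.
Qed.

Lemma covector_sign (t : R) q0 z : a < t < b -> torus_map T q0 = x0 ->
  let v := 'd (chart_fun c0 \o torus_map T) q0 z in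
  Omega x0 (xi x0) (B x0) v != 0 ->
  0 < fieldline_covector Omega xi B t (v : tangent x0) * Omega x0 (xi x0) (B x0) v.
Proof.
move=> tab q0E v N0; set N := Omega x0 _ _ _ in N0 *.
pose f t := fieldline_covector Omega xi B t (v : tangent x0) * N.
apply: (@interval_locally_constant R (fun t => 0 < f t) a b 0) => //; last first.
  (* At time zero the flow derivative is the identity and the product is [N ^+ 2]. *)
  rewrite /f fieldline_covectorE// tau0 -/N -expr2 lt_neqAle sqr_ge0 andbT eq_sym.
  by rewrite sqrf_eq0.
move=> s sab.
have cf : f @ s --> f s.
  by apply: cvgM; [exact: fieldline_covector_continuous|exact: cvg_cst].
have fs : f s != 0 by rewrite mulf_neq0// covector_neq0.
exact: near_sign cf fs.
Qed.

(** The covector is applied to the Cramer expansion of [v] in [eta], [xi], [B]. The [B] term drops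
    out because the flow carries [B x0] to [B (g t)], which the covector kills. *)
Lemma covector_combination (t : R) (eta v : 'rV[R]_3) : a < t < b ->
  Omega x0 eta (xi x0) (B x0) * fieldline_covector Omega xi B t (v : tangent x0) =
  Omega x0 (xi x0) (B x0) v * fieldline_covector Omega xi B t (eta : tangent x0) +
  Omega x0 eta v (B x0) * fieldline_covector Omega xi B t (xi x0).
Proof.
move=> tab; rewrite !fieldline_covectorE//.
have [[lin alt _] _] := Omega_volume.
have [_ _ l3] := lin (g t) (xi (g t)) (B (g t)).
have [_ _ a23] := alt (g t) (B (g t)) (xi (g t)).
have := cramer3 (omega_trilinear x0) eta (xi x0) (B x0) v.
(* The added [0] gives every term of the expansion the form [k *: u + u'] of the linearity rule. *)
move=> /(congr1 (fun u => Omega (g t) (xi (g t)) (B (g t)) (tau t (u + 0)))).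
have lin0 k u u' : Omega (g t) (xi (g t)) (B (g t)) (tau t (k *: u + u')) =
    k * Omega (g t) (xi (g t)) (B (g t)) (tau t u) +
    Omega (g t) (xi (g t)) (B (g t)) (tau t u').
  by rewrite linearP; exact: l3.
have z0 : Omega (g t) (xi (g t)) (B (g t)) (tau t 0) = 0.
  by rewrite linear0; have := l3 (-1) 0 0; rewrite scaler0 addr0 => /= h; lra.
rewrite -!addrA !lin0 z0 tau_field// a23 mulr0 !addr0 => ->.
congr (_ * _ + _).
exact: (trilinear_cycle (omega_trilinear x0)).
Qed.

(** Otherwise the tangent plane of the torus lies in the span of [xi] and [B]. Since [B] is tangent
    and [xi] is not, the plane would reduce to the line of [B], against the immersion having rank
    two. *)
Lemma torus_transverse_direction (eta : 'rV[R]_3) q0 : torus_map T q0 = x0 ->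
  0 < Omega x0 eta (xi x0) (B x0) ->
  exists z, Omega x0 (xi x0) (B x0) ('d (chart_fun c0 \o torus_map T) q0 z) != 0.
Proof.
move=> q0E k0; apply: contrapT => nz; set L := 'd _ _ in nz.
have Lz z : Omega x0 (xi x0) (B x0) (L z) = 0.
  by apply/eqP; apply/negPn/negP => h; apply: nz; exists z.
have [zB zBE] := torus_tangent_field ab0 q0E.
set k := Omega x0 _ _ _ in k0.
have kn0 : k != 0 by rewrite gt_eqF.
have kz z : exists m, k *: z = m *: zB.
  have := cramer3 (omega_trilinear x0) eta (xi x0) (B x0) (L z); rewrite -/k.
  have -> : Omega x0 (L z) (xi x0) (B x0) = 0.
    by rewrite -[RHS](Lz z); exact: (trilinear_cycle (omega_trilinear x0)).
  rewrite scale0r add0r; set A := Omega _ _ _ _; set m := Omega _ _ _ _ => h.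
  have {}h : k *: L z = A *: (xi x0 : 'rV[R]_3) + m *: L zB by rewrite zBE.
  have LE : L (k *: z - m *: zB) = A *: (xi x0 : 'rV[R]_3).
    rewrite -[RHS](addrK (m *: L zB)) -h.
    by rewrite linearB !linearZ.
  have [A0|A0] := eqVneq A 0.
    exists m; apply/eqP; rewrite -subr_eq0; apply/eqP.
    apply: (@torus_map_immersion _ _ _ T q0); rewrite q0E -/c0 -/L.
    by rewrite LE A0 scale0r.
  exfalso; apply: (T_transverse Tx0).
  exists q0, (A^-1 *: (k *: z - m *: zB)); split=> //.
  rewrite -/c0 -/L linearZ LE.
  have xiE : A^-1 *: (A *: (xi x0 : 'rV[R]_3)) = xi x0 by rewrite scalerA mulVf// scale1r.
  exact: xiE.
(* Both basis vectors of the parameter plane would be multiples of the single vector [zB]. *)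
have [m0 /rowP h0] := kz (delta_mx 0 0); have [m1 /rowP h1] := kz (delta_mx 0 1).
have := h0 0; have := h0 1; have := h1 1; rewrite !mxE /= mulr1 mulr0.
move=> e11 e01 e00; move: kn0; rewrite e11.
have /eqP := esym e01; rewrite mulf_eq0 => /orP[/eqP m00|/eqP ->].
  by move: e00; rewrite m00 mul0r => /eqP; rewrite gt_eqF.
by rewrite mulr0 eqxx.
Qed.

End InvariantTorus.
End Curve.
End ConeField.

(** * Comparison of the slopes at the two times *)

Theorem theorem3p1 (R : realType) (M : manifold R 3) (Omega : field3 M)
    (B xi eta : vector_field M) (x0 : M) (tau tp tm : R)
    (M_orientable : orientable M)
    (Omega_volume : volume_form Omega)
    (B_C1 : C1_field B)
    (B_neq0 : forall x, B x != 0)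
    (B_preserves : preserves B Omega)
    (xi_C1 : C1_field xi)
    (eta_xi_B : forall x : M, 0 < Omega x (eta x) (xi x) (B x))
    (tau_gt0 : 0 < tau)
    (fieldline_defined : forall t, - tau <= t <= tau -> flow_defined B t x0)
    (tp_in : - tau <= tp <= tau)
    (tm_in : - tau <= tm <= tau)
    (alpha_tp : 0 < fieldline_covector Omega xi B tp (xi x0))
    (alpha_tm : fieldline_covector Omega xi B tm (xi x0) < 0)
    (slopes : fieldline_slope Omega xi eta B x0 tp <=
              fieldline_slope Omega xi eta B x0 tm) :
  ~ exists T : torus M,
      [/\ flow_invariant B (torus_set T), torus_set T x0
        & torus_transverse T xi].
Proof.
move=> [T [Tinv Tx0 Ttr]]; have [q0 _ q0E] := Tx0.
have curve t : - tau <= t <= tau -> exists g a b,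
    [/\ a < 0 < b, a < t < b, forall t, a < t < b -> integral_at B g t & g 0 = x0].
  by move=> /fieldline_defined[y [a [b [g [? ? /integral_curveP ? ? _]]]]]; exists g, a, b.
have [z N0] : exists z, Omega x0 (xi x0) (B x0)
    ('d (chart_fun (chart_at x0) \o torus_map T) q0 z) != 0.
  have [g [a [b [ab0 _ ig g0]]]] := curve tp tp_in.
  have := @torus_transverse_direction R M Omega B xi Omega_volume B_C1 g a b ig ab0 T Tinv Ttr.
  by rewrite g0 => H; exact: (H Tx0 (eta x0) q0 q0E (eta_xi_B x0)).
set v := 'd _ _ z in N0; set N := Omega x0 _ _ _ in N0.
pose k := Omega x0 (eta x0) (xi x0) (B x0).
have k0 : 0 < k by exact: eta_xi_B.
pose m := Omega x0 (eta x0) v (B x0).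
pose alpha t u := fieldline_covector Omega xi B t (u : tangent x0).
(* The sign of [alpha t v * N] is combined with the expansion of [k * alpha t v], where [k > 0].
   Each time uses its own integral curve, but [v], [N] and [m] depend only on [x0]. *)
have pos t : - tau <= t <= tau ->
    0 < N ^+ 2 * alpha t (eta x0) + (m * N) * alpha t (xi x0).
  move=> /curve[g [a [b [ab0 tab ig g0]]]].
  have := @covector_sign R M Omega B xi Omega_volume B_C1 B_preserves xi_C1 g a b ig ab0
    T Tinv Ttr.
  have := @covector_combination R M Omega B xi Omega_volume B_C1 B_preserves g a b ig ab0 t.
  rewrite g0 => /(_ (eta x0) v tab) E /(_ Tx0 t q0 z tab q0E N0).
  rewrite -/v -/N -/(alpha t v) => s.
  have : 0 < (k * alpha t v) * N by rewrite -mulrA mulr_gt0.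
  rewrite /k /alpha E -/N -/m -/(alpha t _) -/(alpha t _) => h.
  by rewrite [ltRHS](_ : _ = (N * alpha t (eta x0) + m * alpha t (xi x0)) * N)//; ring.
have := pos tp tp_in; have := pos tm tm_in; move: slopes.
rewrite /fieldline_slope -/(alpha tp (eta x0)) -/(alpha tm (eta x0)).
rewrite -/(alpha tp (xi x0)) -/(alpha tm (xi x0)) in alpha_tp alpha_tm *.
move: (alpha tp (xi x0)) (alpha tm (xi x0)) (alpha tp (eta x0)) (alpha tm (eta x0))
  alpha_tp alpha_tm => xp xm ep em xp0 xm0 sl pm pp.
have N2 : 0 < N ^+ 2 by rewrite lt_neqAle sqr_ge0 andbT eq_sym sqrf_eq0.
(* Division by [xp > 0] keeps the inequality and division by [xm < 0] reverses it, so the slope at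
   [tp] strictly exceeds the slope at [tm]. *)
have hp : 0 < N ^+ 2 * (ep / xp) + m * N.
  rewrite -(pmulr_lgt0 _ xp0) mulrDl -mulrA divfK// gt_eqF//.
have hm : N ^+ 2 * (em / xm) + m * N < 0.
  by rewrite -(nmulr_lgt0 _ xm0) mulrDl -mulrA divfK// lt_eqF.
have := ler_wpM2l (ltW N2) sl; lra.
Qed.
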